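(* Let $0<d<1$, let $S\subset\mathbb{R}$ be a compact set, and let $\Lambda\subset\mathbb{R}$ be a uniformly discrete set. Suppose there exist functions $f_\xi\in PW_S$, $\xi\in\Lambda$, satisfying $$\sup_{\xi\in\Lambda}\|f_\xi\|_{L^2(\mathbb{R})}<\infty$$ and $$\|f_\xi|_\Lambda-\delta_\xi\|_{l^2(\Lambda)}\le d\quad\text{for every }\xi\in\Lambda.$$ Then $$m(S)\ge 2\pi(1-d^2)\,D^+(\Lambda).$$ Moreover, this inequality is sharp for every $d$: for every $0<d<1$ there exist a compact set $S$, a uniformly discrete set $\Lambda$ and functions $f_\xi\in PW_S$, $\xi\in\Lambda$, satisfying the two conditions above, for which $m(S)=2\pi(1-d^2)D^+(\Lambda)$ and $D^+(\Lambda)>0$.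
   Context: $m$ denotes Lebesgue measure on $\mathbb{R}$. The Fourier transform is $\hat F(x)=\int_{\mathbb{R}}e^{itx}F(t)\,dt$. For a compact set $S\subset\mathbb{R}$, the Paley--Wiener space is $PW_S=\{f\in L^2(\mathbb{R}): f=\hat F,\ F\in L^2(\mathbb{R}),\ F=0 \text{ on }\mathbb{R}\setminus S\}$ with the $L^2(\mathbb{R})$-norm; its elements are continuous functions (they extend to entire functions), so restrictions to $\Lambda$ are defined pointwise. A set $\Lambda\subset\mathbb{R}$ is uniformly discrete if $\inf_{\lambda,\lambda'\in\Lambda,\lambda\ne\lambda'}|\lambda-\lambda'|>0$. For $\xi\in\Lambda$, $\delta_\xi:\Lambda\to\{0,1\}$ is the function with $\delta_\xi(\xi)=1$ and $\delta_\xi(\lambda)=0$ for $\lambda\in\Lambda$, $\lambda\neq\xi$. The upper uniform density is $$D^+(\Lambda)=\lim_{r\to\infty}\max_{a\in\mathbb{R}}\frac{\mathrm{card}(\Lambda\cap(a,a+r))}{r}.$$ *)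

(* Defs.v *)
From HB Require Import structures.
From mathcomp Require Import all_boot all_order all_algebra.
From mathcomp Require Export complex.
From mathcomp Require Import all_classical all_reals all_analysis.

Set Implicit Arguments.
Unset Strict Implicit.
Unset Printing Implicit Defensive.

Import Order.TTheory GRing.Theory Num.Theory.
Import numFieldNormedType.Exports.

Local Open Scope classical_set_scope.
Local Open Scope ring_scope.
Local Open Scope complex_scope.

Definition cmeasurable_fun (R : realType) (F : R -> R[i]) : Prop :=
  measurable_fun [set: R] (fun t => complex.Re (F t)) /\
  measurable_fun [set: R] (fun t => complex.Im (F t)).

Definition L2norm (R : realType) (F : R -> R[i]) : \bar R :=
  ('N[lebesgue_measure]_2%:E [(fun t => (Normc.normc (F t))%:E)])%E.

Definition L2 (R : realType) : set (R -> R[i]) :=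
  [set F | cmeasurable_fun F /\ (L2norm F < +oo)%E].

Definition expi (R : realType) (x : R) : R[i] := cos x +i* sin x.

Definition integralC (R : realType) (F : R -> R[i]) : R[i] :=
  (\int[lebesgue_measure]_(t in [set: R]) complex.Re (F t)) +i*
  (\int[lebesgue_measure]_(t in [set: R]) complex.Im (F t)).

(* No normalising factor.  The integral converges absolutely when F is
   integrable, in particular when F is in L^2 and vanishes outside a compact
   set; no L^2 extension of the transform is needed for PW. *)
Definition fourier (R : realType) (F : R -> R[i]) (x : R) : R[i] :=
  integralC (fun t => expi (t * x) * F t).

(* The equality f = fourier F is pointwise, which selects the continuous
   representative of each L^2 class and gives a meaning to restrictions of f
   to discrete sets. *)
Definition PW (R : realType) (S : set R) : set (R -> R[i]) :=
  [set f | L2 f /\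
    exists F : R -> R[i],
      [/\ L2 F, (forall t, ~ S t -> F t = 0) & (forall x, f x = fourier F x)]].

(* The infimum is taken in \bar R, so that it is +oo when Lam has at most one
   point. *)
Definition uniformly_discrete (R : realType) (Lam : set R) : Prop :=
  (0 < ereal_inf [set e | exists x y : R,
     [/\ Lam x, Lam y, x != y & e = `|x - y|%:E]])%E.

Definition l2norm (R : realType) (Lam : set R) (c : R -> R[i]) : \bar R :=
  ((\esum_(l in Lam) (Normc.normc (c l) ^+ 2)%:E) `^ 2^-1)%E.

Definition delta (R : realType) (xi : R) (l : R) : R[i] := (l == xi)%:R.

(* For uniformly discrete Lam and r > 0, the supremum over a is that of a
   bounded set of multiples of 1 / r, hence a maximum, and the limit exists
   by subadditivity of the maximal cardinality in r. *)
Definition upper_density (R : realType) (Lam : set R) : \bar R :=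
  lim ((fun r : R =>
    ereal_sup [set (counting (Lam `&` `]a, (a + r)%R[) * (r^-1)%R%:E)%E
              | a in [set: R]]) @ +oo).

(* Main.v *)
Require Import Defs.
From HB Require Import structures.
From mathcomp Require Import all_boot all_order all_algebra finmap.
From mathcomp Require Import all_classical all_reals all_analysis.
From mathcomp Require Import measurable_realfun lebesgue_integral_under.
From mathcomp Require Import ring lra.

Import Order.TTheory GRing.Theory Num.Theory.
Import numFieldNormedType.Exports.

Set Implicit Arguments.
Unset Strict Implicit.
Unset Printing Implicit Defensive.

Local Open Scope classical_set_scope.
Local Open Scope ring_scope.

(** Let l_1, ..., l_n be the points of Lam in a window of length r, and let A be
    the matrix with entries f_(l_i)(l_j).  By hypothesis every row of A is within
    d of the corresponding row of the identity, so A is at Hilbert-Schmidt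
    distance at most d sqrt n from the identity.  If A had rank K, the theorem of
    Eckart and Young [card_le_rank_of_rows_near_delta] would give
    n (1 - d^2) <= K.  The inequality follows because A is close to a matrix of
    rank about r m(S) / (2 pi) [count_bound]: divide by r and let r grow
    [window_card, window_density].

    The rank.  Each f_xi is the Fourier transform of some F_xi supported in S.
    Cover S by N disjoint cells of length w with N w close to m(S)
    [compact_cell_cover].  On one cell, mapped affinely to [-a, a] with a < pi
    close to pi, the exponentials e^(itx) for x in the window become, up to
    factors depending on t alone or on x alone, e^(isu) with s in an interval of
    length r w / (2 a).  Integer s give powers of z = e^(iu);
    the fractional part theta is absorbed by approximating e^(i theta u) by a
    Laurent polynomial in z of degree M, with error O(M^2 q^M) where
    q = sin^2 (a / 2) < 1 [exp_approx_error].  It comes from the Taylor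
    series of cos (theta u) in powers of hav u = sin^2 (u / 2): truncated at the
    order M, the series satisfies the equation of the harmonic oscillator up to
    a term of size hav^M.  With M a small multiple of r, the Laurent polynomials
    cost few dimensions and their errors are exponentially small in r
    [exp_cell_approx].

    The errors have to be integrated against F_xi, of which only the L^2 norm of
    the Fourier transform is known to be bounded uniformly in xi.  This needs one
    inequality of the theorem of Plancherel, and only against bounded functions
    on an interval [weak_plancherel].  It is proved by duality, with an
    exponential damping on the Fourier side that makes Fubini's theorem
    applicable and amounts to a convolution with the Poisson kernel on the
    other side [damped_plancherel].

    Sharpness.  Put c = 1 - d^2, S = [-pi c, pi c] and let Lam be the integers,
    which have density 1.  The function
    f_xi(x) = sin (pi c (x - xi)) / (pi (x - xi)) takes the value c at xi, and
    its values at the integers are the Fourier coefficients of the indicator of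
    S, whose squares add up to at most c by Bessel's inequality.  Hence
    |f_xi - delta_xi|^2 <= (1 - c)^2 + c - c^2 = d^2 [band_error]. *)

(** * Matrices close to the identity *)

Section NearIdentity.
Local Open Scope sesquilinear_scope.

Lemma trace_mulmx_conj (C : numClosedFieldType) m n (A : 'M[C]_(m, n)) :
  \tr (A *m A^t*) = \sum_i \sum_j `|A i j| ^+ 2.
Proof.
rewrite /mxtrace; apply: eq_bigr => i _; rewrite mxE.
by apply: eq_bigr => j _; rewrite !mxE normCK.
Qed.

(** The case of the identity in the theorem of Eckart and Young.  If the rows
    of V are orthonormal and their span contains the rows of B, then A *m B has the
    form M *m V, and expanding the square gives
    |M V - 1|^2 = |M - V^t*|^2 + tr (1 - V^t* V), where V^t* V is a projection
    of trace k. *)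
Lemma rank_near_identity (C : numClosedFieldType) n k (A : 'M[C]_(n, k))
    (B : 'M[C]_(k, n)) : (k <= n)%N ->
  n%:R - k%:R <= \sum_i \sum_j `|(A *m B - 1%:M) i j| ^+ 2.
Proof.
move=> kn; pose V := schmidt B.
have VU : V *m V^t* = 1%:M by apply/unitarymxP; exact: schmidt_unitarymx.
have [D ->] : exists D, B = D *m V by apply/submxP; exact: schmidt_sub.
rewrite -trace_mulmx_conj mulmxA; set M := A *m D.
have -> : (M *m V - 1%:M) *m (M *m V - 1%:M)^t* =
    (M - V^t*) *m (M - V^t*)^t* + 1%:M - V^t* *m V.
  rewrite ![(_ - _)^T]linearB /= ![map_mx _ (_ - _)]map_mxB trmxCK trmx1 map_mx1.
  rewrite trmx_mul map_mxM.
  rewrite !mulmxBl !mulmxBr !mulmx1 !mul1mx.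
  rewrite -!mulmxA [V *m _]mulmxA VU mul1mx.
  rewrite !opprB -!addrA; congr (_ + (_ + _)).
  by rewrite [RHS]addrC -addrA subrK addrC.
rewrite [\tr (_ - _ *m V)]linearB /= [\tr (_ + 1%:M)]linearD /=.
rewrite (mxtrace_mulC _ V) VU !mxtrace1 -addrA lerDr trace_mulmx_conj.
by apply: sumr_ge0 => i _; apply: sumr_ge0 => j _; rewrite exprn_ge0.
Qed.

(** For k below n this is [rank_near_identity], a factorisation through K
    being what bounds the rank of the matrix of the sums; otherwise it is
    trivial. *)
Lemma card_le_rank_of_rows_near_delta (R : realType) n (K : finType)
    (X : 'I_n -> K -> R[i]) (Y : K -> 'I_n -> R[i]) (e : R) : 0 <= e ->
  (forall i, \sum_j Normc.normc (\sum_k X i k * Y k j - (i == j)%:R) ^+ 2 <= e) ->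
  n%:R * (1 - e) <= #|K|%:R.
Proof.
move=> e0 hXY; have [nK|Kn] := leqP n #|K|.
  rewrite (le_trans (y := n%:R)) ?ler_nat//.
  by rewrite ler_piMr// lerBlDr lerDl.
pose A : 'M[R[i]]_(n, #|K|) := \matrix_(i, k) X i (enum_val k).
pose B : 'M[R[i]]_(#|K|, n) := \matrix_(k, j) Y (enum_val k) j.
have := rank_near_identity A B (ltnW Kn).
have -> : \sum_i \sum_j `|(A *m B - 1%:M) i j| ^+ 2 =
  (\sum_i \sum_j Normc.normc (\sum_k X i k * Y k j - (i == j)%:R) ^+ 2)%:C%C.
  rewrite rmorph_sum; apply: eq_bigr => i _.
  rewrite rmorph_sum; apply: eq_bigr => j _.
  rewrite rmorphXn; congr (_ ^+ 2); congr ((Normc.normc _)%:C)%C.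
  rewrite !mxE; congr (_ - _); rewrite (reindex _ (onW_bij _ (@enum_val_bij K))) /=.
  by under eq_bigr do rewrite !mxE.
rewrite -!(rmorph_nat (real_complex R)) -rmorphB lecR => h.
rewrite mulrBr mulr1 lerBlDr -lerBlDl (le_trans h)//.
rewrite mulrC mulr_natr -[X in _ *+ X]card_ord -sumr_const.
exact: ler_sum.
Qed.

End NearIdentity.

(** * Approximation of exponentials on an arc by polynomials *)

Section ForcedOscillator.
Context {R : realType}.
Implicit Types (t a B k theta : R) (n M : nat).

Lemma is_derive_ext (f g : R -> R) t df dg : is_derive t 1 f df ->
  (forall x, f x = g x) -> df = dg -> is_derive t 1 g dg.
Proof. by move=> + /funext fg <-; rewrite fg. Qed.

Lemma is_derive_cosM k t :
  is_derive t 1 (fun x => cos (k * x)) (- (k * sin (k * t))).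
Proof.
have h : is_derive t 1 ( *%R k) k.
  apply: is_derive_ext (is_deriveZ k (is_derive_id t 1)) _ _ => //.
  by rewrite /GRing.scale /= mulr1.
apply: is_derive_ext (is_derive1_comp (is_derive_cos (k * t)) h) _ _ => //.
by rewrite mulNr mulrC.
Qed.

Lemma is_derive_sinM k t :
  is_derive t 1 (fun x => sin (k * x)) (k * cos (k * t)).
Proof.
have h : is_derive t 1 ( *%R k) k.
  apply: is_derive_ext (is_deriveZ k (is_derive_id t 1)) _ _ => //.
  by rewrite /GRing.scale /= mulr1.
apply: is_derive_ext (is_derive1_comp (is_derive_sin (k * t)) h) _ _ => //.
by rewrite mulrC.
Qed.

Lemma is_derive_continuous (f f' : R -> R) :
  (forall t, is_derive t 1 f (f' t)) -> continuous f.
Proof.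
move=> df t; apply/differentiable_continuous/derivable1_diffP.
exact: ex_derive.
Qed.

Lemma norm_le_of_derive_le (f f' : R -> R) a B :
  (forall t, is_derive t 1 f (f' t)) -> f 0 = 0 ->
  (forall t, `|t| <= a -> `|f' t| <= B) ->
  forall t, `|t| <= a -> `|f t| <= B * a.
Proof.
move=> df f0 fB t ta.
have a0 : 0 <= a by rewrite (le_trans _ ta).
have B0 : 0 <= B by rewrite (le_trans _ (fB 0 _))// normr0.
have cf (A : set R) : {within A, continuous f}.
  by apply: continuous_subspaceT; exact: (is_derive_continuous df).
have [c ca ft] : exists2 c, `|c| <= a & f t = f' c * t.
  have [t0|t0] := lerP 0 t.
    have [c] := MVT_segment t0 (fun x _ => df x) (cf _).
    rewrite in_itv/= f0 !subr0 => /andP[c0 ct] ->; exists c => //.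
    by rewrite ger0_norm// (le_trans ct)// (le_trans (ler_norm _)).
  have [c] := MVT_segment (ltW t0) (fun x _ => df x) (cf _).
  rewrite in_itv/= f0 !sub0r mulrN => /andP[tc c0] /oppr_inj ->; exists c => //.
  by rewrite (le_trans _ ta)// !ler0_norm ?lerN2// ltW.
by rewrite ft normrM ler_pM// fB.
Qed.

(** Multiplying the equation y'' + theta^2 y = g by cos (theta t) or by
    sin (theta t) makes its left-hand side an exact derivative; the two first
    integrals obtained in this way determine y' and theta y. *)
Lemma forced_oscillator_bound theta a B (y y1 y2 : R -> R) :
  (forall t, is_derive t 1 y (y1 t)) -> (forall t, is_derive t 1 y1 (y2 t)) ->
  y 0 = 0 -> y1 0 = 0 ->
  (forall t, `|t| <= a -> `|y2 t + theta ^+ 2 * y t| <= B) ->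
  forall t, `|t| <= a ->
    `|theta * y t| <= B * a *+ 2 /\ `|y1 t| <= B * a *+ 2.
Proof.
move=> dy dy1 y0 y10 hB t ta.
pose u x := cos (theta * x) * y1 x + theta * (sin (theta * x) * y x).
pose v x := sin (theta * x) * y1 x - theta * (cos (theta * x) * y x).
have du (x : R) : is_derive x 1 u (cos (theta * x) * (y2 x + theta ^+ 2 * y x)).
  have h1 := is_deriveM (is_derive_cosM theta x) (dy1 x).
  have h2 := is_deriveZ theta (is_deriveM (is_derive_sinM theta x) (dy x)).
  apply: is_derive_ext (is_deriveD h1 h2) _ _ => //.
  by rewrite /GRing.scale /=; ring.
have dv (x : R) : is_derive x 1 v (sin (theta * x) * (y2 x + theta ^+ 2 * y x)).
  have h1 := is_deriveM (is_derive_sinM theta x) (dy1 x).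
  have h2 := is_deriveZ theta (is_deriveM (is_derive_cosM theta x) (dy x)).
  apply: is_derive_ext (is_deriveB h1 h2) _ _ => //.
  by rewrite /GRing.scale /=; ring.
have c1 := @cos_max R; have s1 := @sin_max R.
have uB : `|u t| <= B * a.
  apply: (norm_le_of_derive_le du) => // [|x xa].
    by rewrite /u y0 y10; ring.
  by rewrite normrM (le_trans _ (hB x xa))// ler_piMl.
have vB : `|v t| <= B * a.
  apply: (norm_le_of_derive_le dv) => // [|x xa].
    by rewrite /v y0 y10; ring.
  by rewrite normrM (le_trans _ (hB x xa))// ler_piMl.
have cs := cos2Dsin2 (theta * t).
have -> : theta * y t = sin (theta * t) * u t - cos (theta * t) * v t.
  rewrite /u /v -[LHS]mul1r -cs; ring.
have -> : y1 t = cos (theta * t) * u t + sin (theta * t) * v t.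
  rewrite /u /v -[LHS]mul1r -cs; ring.
rewrite mulr2n; split.
  by rewrite (le_trans (ler_normB _ _))// lerD// normrM;
     [rewrite (le_trans _ uB)|rewrite (le_trans _ vB)]; rewrite ?ler_piMl.
by rewrite (le_trans (ler_normD _ _))// lerD// normrM;
   [rewrite (le_trans _ uB)|rewrite (le_trans _ vB)]; rewrite ?ler_piMl.
Qed.

(** The haversine, equal to sin^2 (t / 2). *)
Definition hav t : R := (1 - cos t) / 2.

Lemma is_derive_hav t : is_derive t 1 hav (sin t / 2).
Proof.
have h := is_deriveB (is_derive_cst (1 : R) t 1) (is_derive_cos t).
apply: is_derive_ext (is_deriveZ (2^-1 : R) h) _ _ => [x|].
  by rewrite /hav /GRing.scale /= mulrC.
by rewrite /GRing.scale /= sub0r opprK mulrC.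
Qed.

Lemma is_derive_havX n t :
  is_derive t 1 (fun x => hav x ^+ n) (n%:R / 2 * (hav t ^+ n.-1 * sin t)).
Proof.
apply: is_derive_ext (is_deriveX n (is_derive_hav t)) _ _ => [x|].
  by rewrite exprfctE.
by rewrite /GRing.scale /=; ring.
Qed.

(** By sin^2 = 4 hav (1 - hav), the second derivative of a power of hav
    involves only the same power and the previous one; the two-term recurrence
    of [hav_coef] comes from this. *)
Lemma is_derive2_havX n t :
  is_derive t 1 (fun x => n%:R / 2 * (hav x ^+ n.-1 * sin x))
    (n%:R * (n%:R - 2^-1) * hav t ^+ n.-1 - n%:R ^+ 2 * hav t ^+ n).
Proof.
have h := is_deriveM (is_derive_havX n.-1 t) (is_derive_sin t).
apply: is_derive_ext (is_deriveZ (n%:R / 2) h) _ _ => //.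
have c t' : cos t' = 1 - 2 * hav t' by rewrite /hav; field.
have s2 t' : sin t' ^+ 2 = 4 * hav t' * (1 - hav t').
  by rewrite sin2cos2 c; ring.
rewrite /GRing.scale /= c; case: n {h} => [|[|n]] /=; first by ring.
  by field.
rewrite [X in _ * (_ + X)](_ : _ =
    n.+1%:R / 2 * (hav t ^+ n * sin t ^+ 2)); last by ring.
by rewrite s2 !exprS -!natr1; field.
Qed.

End ForcedOscillator.

Section CosineTaylor.
Context {R : realType}.
Implicit Types (t a B k theta : R) (n M : nat).
Local Open Scope complex_scope.

Lemma expiD (x y : R) : expi (x + y) = expi x * expi y.
Proof. by rewrite /expi cosD sinD; simpc; congr (_ +i* _); ring. Qed.

Lemma expi0 : expi (0 : R) = 1.
Proof. by rewrite /expi cos0 sin0. Qed.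

Lemma expiMn n (x : R) : expi (n%:R * x) = expi x ^+ n.
Proof.
elim: n => [|n IH]; first by rewrite mul0r expi0.
by rewrite -natr1 mulrDl mul1r expiD IH exprSr.
Qed.

Lemma expiNK (x : R) : expi (- x) * expi x = 1.
Proof. by rewrite -expiD addNr expi0. Qed.

Lemma normc_expi (x : R) : Normc.normc (expi x) = 1.
Proof. by rewrite /= cos2Dsin2 sqrtr1. Qed.

(** The Taylor coefficients at h = 0 of cos (theta t) as a function of
    h = hav t. *)
Fixpoint hav_coef theta n : R :=
  if n is n'.+1 then
    hav_coef theta n' * (n'%:R ^+ 2 - theta ^+ 2) / (n'.+1%:R * (n'%:R + 2^-1))
  else 1.

Definition cos_approx theta M t :=
  \sum_(n < M.+1) hav_coef theta n * hav t ^+ n.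

Definition cos_approx' theta M t :=
  \sum_(n < M.+1) hav_coef theta n * (n%:R / 2 * (hav t ^+ n.-1 * sin t)).

Definition cos_approx'' theta M t :=
  \sum_(n < M.+1) hav_coef theta n *
    (n%:R * (n%:R - 2^-1) * hav t ^+ n.-1 - n%:R ^+ 2 * hav t ^+ n).

Lemma is_derive_cos_approx theta M t :
  is_derive t 1 (cos_approx theta M) (cos_approx' theta M t).
Proof.
have h (n : 'I_M.+1) := is_deriveZ (hav_coef theta n) (is_derive_havX n t).
by apply: is_derive_ext (is_derive_sum h) _ _ => // x; rewrite fct_sumE.
Qed.

Lemma is_derive_cos_approx' theta M t :
  is_derive t 1 (cos_approx' theta M) (cos_approx'' theta M t).
Proof.
have h (n : 'I_M.+1) := is_deriveZ (hav_coef theta n) (is_derive2_havX n t).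
by apply: is_derive_ext (is_derive_sum h) _ _ => // x; rewrite fct_sumE.
Qed.

(** The recurrence makes the contributions of all powers of hav cancel except
    the last one: the truncated series solves the equation of the harmonic
    oscillator up to a term of size hav^M. *)
Lemma cos_approx_ode theta M t :
  cos_approx'' theta M t + theta ^+ 2 * cos_approx theta M t =
  - (hav_coef theta M * (M%:R ^+ 2 - theta ^+ 2) * hav t ^+ M).
Proof.
rewrite /cos_approx'' /cos_approx; elim: M => [|M IH].
  by rewrite !big_ord1 /=; ring.
rewrite (big_ord_recr M.+1) [in X in _ + X](big_ord_recr M.+1) /=.
move: IH; set A := \sum_(n < M.+1) _; set B := \sum_(n < M.+1) _ => IH.
have -> : A = - (hav_coef theta M * (M%:R ^+ 2 - theta ^+ 2) * hav t ^+ M) -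
    theta ^+ 2 * B by rewrite -IH addrK.
rewrite -natr1; have : M%:R >= 0 :> R by [].
move: (M%:R) => m m0; field.
by rewrite !gt_eqF //=; lra.
Qed.

(** The first coefficient is - 2 theta^2, and later ratios
    (n^2 - theta^2) / ((n + 1) (n + 1/2)) are at most 1 in absolute value. *)
Lemma hav_coef_bound theta n : 1 <= theta <= 2 -> `|hav_coef theta n| <= 8.
Proof.
move=> /andP[t1 t2]; have t0 : 0 <= theta by lra.
have th4 : theta ^+ 2 <= 4 by nra.
have th1 : 1 <= theta ^+ 2 by nra.
case: n => [|n]; first by rewrite normr1 ler1n.
elim: n => [|n IH].
  rewrite /= expr0n /= sub0r mul1r add0r mul1r invrK normrM normrN.
  by rewrite !ger0_norm//; nra.
rewrite [hav_coef _ _]/= -/(hav_coef theta n.+1) -mulrA normrM.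
rewrite -[leRHS]mulr1 ler_pM// normrM normfV ler_pdivrMr ?mul1r; last first.
  by rewrite normr_gt0 mulf_neq0// ?pnatr_eq0// gt_eqF// ltr_wpDl.
have m1 : 1 <= n.+1%:R :> R by rewrite ler1n.
rewrite (ger0_norm (x := _ * _)); last by rewrite mulr_ge0// addr_ge0.
rewrite -natr1; set m := (n.+1%:R : R) in m1 *.
rewrite ler_norml; apply/andP; split; nra.
Qed.

End CosineTaylor.

Section ExponentialPolynomial.
Context {R : realType}.
Implicit Types (t a B k theta : R) (n M : nat).
Local Open Scope complex_scope.

(** On the unit circle z = e^(it), these two polynomials are z hav t and
    z sin t. *)
Definition hav_poly : {poly R[i]} := (- 4^-1)%:C *: (1 - 'X) ^+ 2.

Definition sin_poly : {poly R[i]} := (0 -i* 2^-1) *: ('X ^+ 2 - 1).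

Lemma horner_hav_poly t : hav_poly.[expi t] = (hav t)%:C * expi t.
Proof.
rewrite /hav_poly hornerZ horner_exp !hornerE ?expr2 /expi /hav.
have h : sin t * sin t = 1 - cos t * cos t by rewrite -!expr2 sin2cos2.
simpc; by congr (_ +i* _); lra.
Qed.

Lemma horner_sin_poly t : sin_poly.[expi t] = (sin t)%:C * expi t.
Proof.
rewrite /sin_poly hornerZ hornerD horner_exp !hornerE ?expr2 /expi.
have h : sin t * sin t = 1 - cos t * cos t by rewrite -!expr2 sin2cos2.
simpc; by congr (_ +i* _); lra.
Qed.

Lemma size_hav_polyX n : (size (hav_poly ^+ n) <= n.*2.+1)%N.
Proof.
have s3 : (size hav_poly <= 3)%N.
  rewrite (leq_trans (size_scale_leq _ _))// (leq_trans (size_poly_exp_leq _ _))//.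
  by rewrite -opprB size_polyN size_XsubC.
rewrite (leq_trans (size_poly_exp_leq _ _))// ltnS -mul2n leq_mul//.
by case: size s3.
Qed.

Lemma size_sin_poly : (size sin_poly <= 3)%N.
Proof.
rewrite (leq_trans (size_scale_leq _ _))// (leq_trans (size_polyD _ _))//.
by rewrite size_polyXn size_polyN size_poly1.
Qed.

(** Since cos (theta t) is close to P = cos_approx theta M and sin (theta t) to
    - P' / theta, the exponential e^(i theta t) is close to P - i P' / theta,
    which is a Laurent polynomial in z = e^(it); this is z^M times it. *)
Definition exp_poly theta M : {poly R[i]} := \sum_(n < M.+1)
  (hav_coef theta n)%:C *: ((hav_poly ^+ n
     - (0 +i* (n%:R / 2 / theta)) *: (hav_poly ^+ n.-1 * sin_poly))
   * 'X ^+ (M - n)).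

Lemma size_exp_poly theta M : (size (exp_poly theta M) <= M.*2.+1)%N.
Proof.
apply: (leq_trans (size_sum _ _ _)); apply/bigmax_leqP => -[n nM] _ /=.
apply: (leq_trans (size_scale_leq _ _)); apply: (leq_trans (size_polyMleq _ _)).
rewrite size_polyXn addnS /=; move: nM; rewrite ltnS => nM.
rewrite (@leq_trans (n.*2.+1 + (M - n))%N)//; last first.
  by rewrite addSn ltnS -addnn -addnA subnKC// -addnn leq_add2r.
rewrite leq_add2r (leq_trans (size_polyD _ _))// geq_max size_hav_polyX size_polyN.
case: n nM => [|n] nM; first by rewrite !mul0r scale0r size_poly0.
apply: (leq_trans (size_scale_leq _ _)); apply: (leq_trans (size_polyMleq _ _)).
have := leq_add (size_hav_polyX n) size_sin_poly.
by case: (_ + _)%N => //= m; rewrite addnC doubleS.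
Qed.

Lemma sum_complex (I : finType) (F G : I -> R) :
  \sum_i (F i +i* G i) = (\sum_i F i) +i* (\sum_i G i).
Proof.
by elim/big_rec3: _ => [//|i x y z _ ->]; simpc.
Qed.

Lemma horner_exp_poly theta M t : 
  expi (- (M%:R * t)) * (exp_poly theta M).[expi t] =
  cos_approx theta M t +i* - (cos_approx' theta M t / theta).
Proof.
have E n : (n <= M)%N -> expi (- (M%:R * t)) * (expi t ^+ n * expi t ^+ (M - n)) = 1.
  by move=> nM; rewrite -exprD subnKC// -expiMn expiNK.
rewrite /exp_poly horner_sum mulr_sumr /cos_approx /cos_approx' mulr_suml -sumrN.
rewrite -sum_complex; apply: eq_bigr => -[n nM] _ /=; rewrite ltnS in nM.
rewrite hornerZ hornerM hornerXn hornerD hornerN hornerZ hornerM !horner_exp.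
rewrite horner_hav_poly horner_sin_poly.
move/(_ n nM): E; move: (hav t) (sin t) (expi t) (expi _) => h s z w E.
rewrite !exprMn [X in _ - X](_ : _ =
    (0 +i* (n%:R / 2 / theta)) * (h ^+ n.-1 * s)%:C * z ^+ n); last first.
  case: n {nM E} => [|n]; first by rewrite !mul0r.
  by rewrite (rmorphM (real_complex R)) (rmorphXn (real_complex R)) exprSr; ring.
rewrite -(rmorphXn (real_complex R)); set p := h ^+ n; set q := h ^+ n.-1 * s.
set c := hav_coef theta n; set k := n%:R / 2 / theta.
rewrite -mulrBl; transitivity (c%:C * (p%:C - (0 +i* k) * q%:C) *
  (w * (z ^+ n * z ^+ (M - n)))); first by ring.
by rewrite E mulr1; simpc; congr (_ +i* _); rewrite /k; ring.
Qed.

Lemma normc_le_ReIm (x y : R) : Normc.normc (x +i* y) <= `|x| + `|y|.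
Proof.
rewrite /= -(ger0_norm (addr_ge0 (normr_ge0 x) (normr_ge0 y))) -sqrtr_sqr.
rewrite ler_wsqrtr// sqrrD !real_normK ?num_real//.
by rewrite lerD2r lerDl mulrn_wge0// mulr_ge0.
Qed.

Lemma hav_bound a t : a <= pi -> `|t| <= a -> `|hav t| <= hav a.
Proof.
move=> api ta; have h0 : 0 <= hav t by rewrite divr_ge0// subr_ge0 cos_le1.
rewrite ger0_norm// /hav ler_pM2r ?invr_gt0// lerD2l lerN2 -(cos_norm t).
rewrite leNgt ltr_cos -?leNgt// in_itv/= ?(le_trans ta)// ?normr_ge0//.
by rewrite (le_trans _ ta).
Qed.

(** The error y = cos_approx - cos (theta t) vanishes at 0 with its derivative
    and satisfies y'' + theta^2 y = O(M^2 hav^M) by [cos_approx_ode], so that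
    y and y' are as small by [forced_oscillator_bound].  As hav a < 1 for
    a < pi, the error decays geometrically in M on a closed arc that does not
    contain -1. *)
Lemma exp_approx_error theta M a t : 1 <= theta <= 2 -> a < pi -> `|t| <= a ->
  Normc.normc (expi (theta * t) - expi (- (M%:R * t)) * (exp_poly theta M).[expi t])
    <= 32 * pi * (M%:R ^+ 2 + 4) * hav a ^+ M.
Proof.
move=> th api ta; have a0 : 0 <= a by rewrite (le_trans _ ta).
have tt : theta != 0 by apply/eqP; lra.
pose y x := cos_approx theta M x - cos (theta * x).
pose y1 x := cos_approx' theta M x + theta * sin (theta * x).
pose y2 x := cos_approx'' theta M x + theta ^+ 2 * cos (theta * x).
have dy (x : R) : is_derive x 1 y (y1 x).
  apply: is_derive_ext (is_deriveB (is_derive_cos_approx theta M x)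
    (is_derive_cosM theta x)) _ _ => //.
  by rewrite opprK.
have dy1 (x : R) : is_derive x 1 y1 (y2 x).
  apply: is_derive_ext (is_deriveD (is_derive_cos_approx' theta M x)
    (is_deriveZ theta (is_derive_sinM theta x))) _ _ => //.
  by rewrite /y2 expr2 /GRing.scale /= mulrA.
have hav0 : hav (0 : R) = 0 by rewrite /hav cos0 subrr mul0r.
have y0 : y 0 = 0.
  rewrite /y /cos_approx mulr0 cos0 big_ord_recl /= big1 ?hav0 ?addr0 ?mulr1 ?subrr//.
  by move=> i _; rewrite expr0n mulr0.
have y10 : y1 0 = 0.
  rewrite /y1 /cos_approx' mulr0 !sin0 big1 ?mulr0 ?addr0//.
  by move=> i _; rewrite !mulr0.
set B := 8 * (M%:R ^+ 2 + 4) * hav a ^+ M.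
have hav_ge0 : 0 <= hav a by rewrite divr_ge0// subr_ge0 cos_le1.
have yB (x : R) : `|x| <= a -> `|y2 x + theta ^+ 2 * y x| <= B.
  move=> xa; have -> : y2 x + theta ^+ 2 * y x =
    cos_approx'' theta M x + theta ^+ 2 * cos_approx theta M x by rewrite /y2 /y; ring.
  rewrite cos_approx_ode normrN !normrM ler_pM ?mulr_ge0//; last first.
    by rewrite normrX lerXn2r ?nnegrE// hav_bound// ltW.
  rewrite ler_pM ?hav_coef_bound// (le_trans (ler_normB _ _))// lerD//.
    by rewrite normrX ger0_norm.
  by rewrite normrX ger0_norm; nra.
have [h1 h2] := forced_oscillator_bound dy dy1 y0 y10 yB ta.
rewrite horner_exp_poly /expi; simpc.
apply: (le_trans (normc_le_ReIm _ _)).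
have -> : cos (theta * t) - cos_approx theta M t = - y t by rewrite opprB.
have -> : sin (theta * t) + cos_approx' theta M t / theta = y1 t / theta.
  by rewrite /y1; field.
have B0 : 0 <= B.
  by rewrite !mulr_ge0// ?addr_ge0 ?exprn_ge0.
have {}h1 : `|- y t| <= B * a *+ 2.
  rewrite normrN (le_trans _ h1)// normrM ler_peMl// (le_trans _ (ler_norm _))//.
  by case/andP: th.
have {}h2 : `|y1 t / theta| <= B * a *+ 2.
  rewrite (le_trans _ h2)// normrM ler_piMr// ger0_norm ?invr_ge0; last lra.
  by rewrite invf_le1; lra.
have BaBpi : B * a <= B * pi by rewrite ler_wpM2l// ltW.
rewrite (le_trans (lerD h1 h2))// [leRHS](_ : _ = 4 * (B * pi)); last by rewrite /B; ring.
by lra.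
Qed.

End ExponentialPolynomial.

(** * A weak form of the theorem of Plancherel *)

Section OscillatoryTransform.
Context {R : realType}.
Local Notation mu := (@lebesgue_measure R).
Local Notation L1 f := (mu.-integrable setT (EFin \o f)).
Implicit Types (g h : R -> R) (x : R).

Lemma integrable_mul_bounded (g h : R -> R) (M : R) :
  L1 g -> measurable_fun setT h -> (forall x, `|h x| <= M) ->
  L1 (fun x => g x * h x).
Proof.
move=> ig mh hM; have M0 : 0 <= M by rewrite (le_trans _ (hM 0)).
have mg : measurable_fun setT g by apply/measurable_EFinP; exact: (measurable_int mu).
apply: le_integrable (integrableZl measurableT M ig) => //=.
  by apply/measurable_EFinP; exact: measurable_funM.
move=> x _ /=; rewrite lee_fin !normrM (ger0_norm M0) mulrC.
by rewrite ler_wpM2r.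
Qed.

Variable b : R -> R.
Hypothesis cb : continuous b.
Hypothesis b1 : forall x, `|b x| <= 1.

(** With b = cos and b = sin, these are the cosine and sine transforms. *)
Definition transform (g : R -> R) (x : R) := \int[mu]_t (g t * b (t * x)).

Let mbM (x : R) : measurable_fun setT (fun t : R => b (t * x)).
Proof.
apply: continuous_measurable_fun => t.
apply: (continuous_comp (f := fun t : R => t * x)) => //; last exact: cb.
exact: mulrr_continuous.
Qed.

Lemma integrable_transform g (x : R) : L1 g -> L1 (fun t => g t * b (t * x)).
Proof. by move=> ig; exact: (integrable_mul_bounded ig (mbM x)). Qed.

Lemma transform_bound g x : L1 g -> `|transform g x| <= \int[mu]_t `|g t|.
Proof.
move=> ig; rewrite (le_trans (le_normr_Rintegral _ (integrable_transform x ig)))//.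
apply: le_Rintegral => //.
- exact: integrable_norm (integrable_transform x ig).
- exact: integrable_norm ig.
- by move=> t _; rewrite normrM ler_piMr.
Qed.

Lemma continuous_transform g : L1 g -> continuous (transform g).
Proof.
move=> ig x.
have := @continuity_under_integral _ _ _ mu (fun x t => g t * b (t * x)) setT
  measurableT (x - 1) (x + 1) _ _ (fun t => `|g t|).
apply.
- by move=> y _; exact: integrable_transform.
- apply: aeW => t _ y _.
  apply: (continuous_comp (f := fun y : R => b (t * y))); last exact: mulrl_continuous.
  apply: (continuous_comp (f := fun y : R => t * y)); last exact: cb.
  exact: mulrl_continuous.
- exact: integrable_norm.
- by move=> y _; apply: aeW => t _; rewrite normrM ler_piMr.
- by rewrite mem_setE in_itv/= ltrDl ltrBlDr ltrDl ltr01.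
Qed.

Lemma measurable_transform g : L1 g -> measurable_fun setT (transform g).
Proof. by move=> ig; apply: continuous_measurable_fun; exact: continuous_transform. Qed.

Lemma Rintegral_transformC (g h : R -> R) : L1 g -> L1 h ->
  \int[mu]_x (g x * transform h x) = \int[mu]_t (h t * transform g t).
Proof.
move=> ig ih.
have mg : measurable_fun setT g by apply/measurable_EFinP; exact: (measurable_int mu).
have mh : measurable_fun setT h by apply/measurable_EFinP; exact: (measurable_int mu).
pose f (z : R * R) : \bar R := (g z.1 * (h z.2 * b (z.2 * z.1)))%:E.
have mf : measurable_fun setT f.
  apply/measurable_EFinP; apply: measurable_funM.
    exact: measurableT_comp.
  apply: measurable_funM; first exact: measurableT_comp.
  apply: (measurableT_comp (f := b)); first exact: continuous_measurable_fun.
  by apply: measurable_funM.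
have intf : (mu \x mu)%E.-integrable setT f.
  apply/integrable12ltyP => //.
  apply: (@le_lt_trans _ _ (\int[mu]_x (`|g x|%:E * \int[mu]_t `|(h t)%:E|))%E).
    apply: ge0_le_integral => //.
    - by move=> x _; exact: integral_ge0.
    - have mnf : measurable_fun setT (abse \o f) by exact: measurableT_comp.
      have nf0 z : (0 <= (abse \o f) z)%E by exact: abse_ge0.
      exact: (measurable_fun_fubini_tonelli_F (m2 := mu) _ mnf nf0).
    - by apply: emeasurable_funM => //; apply/measurable_EFinP; exact: measurableT_comp.
    - move=> x _; rewrite -ge0_integralZl//; last first.
        by apply/measurable_EFinP; exact: measurableT_comp.
      apply: ge0_le_integral => //.
      + by apply: measurableT_comp => //; apply: (measurableT_comp mf); exact: pair1_measurable.
      + apply: emeasurable_funM => //; apply/measurable_EFinP.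
        exact: measurableT_comp.
      + move=> t _; rewrite /f /= lee_fin !normrM ler_wpM2l//.
        by rewrite ler_piMr.
  rewrite ge0_integralZr//.
  - apply: lte_mul_pinfty => //.
    + exact: integral_ge0.
    + by rewrite ge0_fin_numE ?integral_ge0//; case/integrableP: ig.
    + by case/integrableP: ih.
  - by apply/measurable_EFinP; exact: measurableT_comp.
  - exact: integral_ge0.
have E (k : R -> R) (x c : R) : L1 k ->
    (\int[mu]_t (c * (k t * b (t * x)))%:E = (c * transform k x)%:E)%E.
  move=> ik; rewrite EFinM fineK; last exact: integrable_fin_num (integrable_transform x ik).
  by rewrite -integralZl//; exact: integrable_transform.
rewrite /Rintegral; congr fine; transitivity (\int[mu]_x \int[mu]_t f (x, t))%E.
  by apply: eq_integral => x _; rewrite /f /= E.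
rewrite (Fubini intf); apply: eq_integral => t _; rewrite -E//.
by apply: eq_integral => x _; rewrite /f /= mulrCA (mulrC t).
Qed.

End OscillatoryTransform.

Section PoissonWeight.
Context {R : realType}.
Local Notation mu := (@lebesgue_measure R).
Local Notation L1 f := (mu.-integrable setT (EFin \o f)).
Implicit Types (eps u x t : R) (g h : R -> R).

Definition weight eps : R -> R := (fun x => expR (- (eps * x))) \_ `[0, +oo[.

Lemma is_derive_expRN eps x :
  is_derive x 1 (fun x => expR (- (eps * x))) (- eps * expR (- (eps * x))).
Proof.
have h : is_derive x 1 (fun y : R => - (eps * y)) (- eps).
  apply: is_derive_ext (is_deriveZ (- eps) (is_derive_id x 1)) _ _ => [y|].
    exact: mulNr.
  by rewrite /GRing.scale /= mulr1.
apply: is_derive_ext (is_derive1_comp (g := fun y => - (eps * y)) (is_derive_expR _) h) _ _ => //.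
by rewrite mulrC.
Qed.

Lemma cvgy_expRN eps : 0 < eps -> expR (- (eps * x)) @[x --> +oo] --> (0 : R).
Proof.
move=> e0.
apply: (@cvg_comp _ _ _ ( *%R eps) (fun y => expR (- y)) _ (pinfty_nbhs R)).
  exact: gt0_cvgMry.
exact: cvgr_expR.
Qed.

Let weight_primitive eps u c x := expR (- (eps * x)) *
  (- c / eps + (u * sin (u * x) - eps * cos (u * x)) / (eps ^+ 2 + u ^+ 2)).

(** The constant c >= 1 keeps the integrand nonnegative, as improper integration
    by a primitive requires; comparing c = 1 with c = 2 separates the two terms
    afterwards. *)
Lemma integral_weight eps u (c : R) : 0 < eps -> 1 <= c ->
  (\int[mu]_(x in `[0%R, +oo[) (expR (- (eps * x)) * (c + cos (u * x)))%:E =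
  (c / eps + eps / (eps ^+ 2 + u ^+ 2))%:E)%E.
Proof.
move=> e0 c1; have k0 : 0 < eps ^+ 2 + u ^+ 2 by rewrite ltr_pwDl ?exprn_gt0 ?sqr_ge0.
have dF x : is_derive x 1 (weight_primitive eps u c)
    (expR (- (eps * x)) * (c + cos (u * x))).
  have h1 : is_derive x 1 (fun y => u * sin (u * y) - eps * cos (u * y))
      (u * (u * cos (u * x)) + eps * (u * sin (u * x))).
    apply: is_derive_ext (is_deriveB (is_deriveZ u (is_derive_sinM u x))
      (is_deriveZ eps (is_derive_cosM u x))) _ _ => //.
    by rewrite /GRing.scale /= mulrN opprK.
  have h2 : is_derive x 1 (fun y => - c / eps +
      (u * sin (u * y) - eps * cos (u * y)) / (eps ^+ 2 + u ^+ 2))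
      ((u * (u * cos (u * x)) + eps * (u * sin (u * x))) / (eps ^+ 2 + u ^+ 2)).
    apply: is_derive_ext (is_deriveD (is_derive_cst (- c / eps) x 1)
       (is_deriveZ (eps ^+ 2 + u ^+ 2)^-1 h1)) _ _ => [y|].
      by rewrite -[in RHS](mulrC (eps ^+ 2 + u ^+ 2)^-1).
    by rewrite add0r /GRing.scale /= mulrC.
  apply: is_derive_ext (is_deriveM (is_derive_expRN eps x) h2) _ _ => //.
  by rewrite /GRing.scale /=; field; rewrite ?gt_eqF.
have cF : continuous (weight_primitive eps u c) by exact: is_derive_continuous dF.
rewrite (@ge0_continuous_FTC2y _ _ (weight_primitive eps u c) _ 0).
- rewrite /weight_primitive !mulr0 oppr0 expR0 sin0 cos0; congr (_%:E).
  by field; rewrite ?gt_eqF.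
- move=> x _; rewrite mulr_ge0 ?expR_ge0//.
  by have := cos_geN1 (u * x); lra.
- apply: continuous_subspaceT => x.
  apply: cvgM; first exact: (is_derive_continuous (is_derive_expRN eps)).
  by apply: cvgD; [exact: cvg_cst|exact: (is_derive_continuous (is_derive_cosM u))].
- pose K := `|c / eps| + (`|u| + eps) / (eps ^+ 2 + u ^+ 2).
  have FK x : `|weight_primitive eps u c x| <= expR (- (eps * x)) * K.
    rewrite normrM (ger0_norm (expR_ge0 _)) ler_wpM2l ?expR_ge0//.
    rewrite (le_trans (ler_normD _ _))// mulNr normrN lerD2l normrM normfV.
    rewrite (gtr0_norm k0) ler_pM2r ?invr_gt0// (le_trans (ler_normB _ _))//.
    rewrite !normrM (gtr0_norm e0) lerD// ler_piMr// ?(ltW e0)//.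
      exact: sin_max.
    exact: cos_max.
  have lim : expR (- (eps * x)) * K @[x --> +oo] --> 0.
    by rewrite -[0](mul0r K); apply: cvgMl; exact: cvgy_expRN.
  apply: (@squeeze_cvgr _ _ _ _ (fun x => - (expR (- (eps * x)) * K))
    (fun x => expR (- (eps * x)) * K)) => //.
    by apply: nearW => x; rewrite -ler_norml.
  by rewrite -[0]oppr0; exact: cvgN.
- by move=> x _; have dFx := dF x; exact: ex_derive.
- exact/cvg_at_right_filter/cF.
- by move=> x _; rewrite derive1E; have dFx := dF x; exact: derive_val.
Qed.
End PoissonWeight.

Section PoissonKernel.
Context {R : realType}.
Local Notation mu := (@lebesgue_measure R).
Local Notation L1 f := (mu.-integrable setT (EFin \o f)).
Implicit Types (eps u x t : R) (g h : R -> R).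

Lemma integrable_weight eps : 0 < eps -> L1 (weight eps).
Proof.
move=> e0.
have mE : measurable_fun [set: R] (fun x => expR (- (eps * x))).
  by apply: continuous_measurable_fun; exact: (is_derive_continuous (is_derive_expRN eps)).
rewrite /weight -restrict_EFin; apply/(integrable_mkcond _ _).1 => //.
apply/integrableP; split.
  by apply/measurable_EFinP; exact: measurable_funTS.
have I2 := integral_weight 0 e0 (lexx 1).
apply: (@le_lt_trans _ _ (1 / eps + eps / (eps ^+ 2 + 0 ^+ 2))%:E); last exact: ltry.
rewrite -I2; apply: ge0_le_integral => //.
- by apply/measurable_EFinP; apply: measurableT_comp => //; exact: measurable_funTS.
- apply/measurable_EFinP; apply: measurable_funM; first exact: measurable_funTS.
  apply: measurable_funTS; apply: measurable_funD => //.
  apply: continuous_measurable_fun; exact: (is_derive_continuous (is_derive_cosM 0)).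
- move=> x _ /=; rewrite lee_fin ger0_norm ?expR_ge0//.
  by rewrite mul0r cos0; have := expR_ge0 (- (eps * x)); lra.
Qed.

Lemma weight_ge0 eps x : 0 <= weight eps x.
Proof. by rewrite /weight patchE; case: ifP => // _; exact: expR_ge0. Qed.

Lemma weight_le1 eps x : 0 < eps -> weight eps x <= 1.
Proof.
move=> e0; rewrite /weight patchE; case: ifPn => // /set_mem /=.
rewrite in_itv/= andbT => x0.
by rewrite -expR0 ler_expR oppr_le0 mulr_ge0// ltW.
Qed.

Lemma transform_cos_weight eps u : 0 < eps ->
  transform cos (weight eps) u = eps / (eps ^+ 2 + u ^+ 2).
Proof.
move=> e0; have iw := integrable_weight e0.
have iwc : L1 (fun t => weight eps t * cos (t * u)).
  by apply: integrable_transform => // [|x]; [exact: continuous_cos|exact: cos_max].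
have I (c : R) : 1 <= c ->
    c * (\int[mu]_x weight eps x) + transform cos (weight eps) u =
    c / eps + eps / (eps ^+ 2 + u ^+ 2).
  move=> c1; rewrite /transform -RintegralZl// -RintegralD//; last first.
    by have := integrableZl measurableT c iw.
  have := congr1 fine (integral_weight u e0 c1).
  rewrite -/(Rintegral _ _ _) /= => <-; rewrite [RHS]Rintegral_mkcond.
  apply: eq_Rintegral => x _; rewrite /weight !patchE; case: ifPn => // _.
    by rewrite (mulrC x); ring.
  by rewrite mulr0 mul0r addr0.
by have := I 1 (lexx _); have := I 2 (ler1n _ _); lra.
Qed.

Local Notation K eps u := (eps / (eps ^+ 2 + u ^+ 2)).

(** Transforming twice, with the weight in between: up to the factor pi this
    recovers h when eps tends to 0. *)
Definition smooth eps h t :=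
  transform cos (fun x => weight eps x * transform cos h x) t +
  transform sin (fun x => weight eps x * transform sin h x) t.

Lemma integrable_weight_transform (b : R -> R) eps h : continuous b ->
  (forall x, `|b x| <= 1) -> 0 < eps -> L1 h ->
  L1 (fun x => weight eps x * transform b h x).
Proof.
move=> cb b1 e0 ih; apply: (@integrable_mul_bounded _ _ _ (\int[mu]_t `|h t|)).
- exact: integrable_weight.
- by apply: continuous_measurable_fun; exact: continuous_transform.
- by move=> x; exact: transform_bound.
Qed.

#[local] Hint Resolve sin_max : core.

Lemma continuous_smooth eps h : 0 < eps -> L1 h -> continuous (smooth eps h).
Proof.
move=> e0 ih x; apply: cvgD; apply: continuous_transform => //.
- exact: continuous_cos.
- exact: cos_max.
- by apply: integrable_weight_transform => //; [exact: continuous_cos|exact: cos_max].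
- exact: continuous_sin.
- by apply: integrable_weight_transform => //; exact: continuous_sin.
Qed.

(** Fubini's theorem moves both transforms to the weight, where cos (s - t) is
    recognised and [transform_cos_weight] gives the Poisson kernel. *)
Lemma smoothE eps h t : 0 < eps -> L1 h ->
  smooth eps h t = \int[mu]_s (h s * K eps (t - s)).
Proof.
move=> e0 ih; have iw := integrable_weight e0.
have iwb (b : R -> R) : continuous b -> (forall x, `|b x| <= 1) ->
    L1 (fun x => weight eps x * b (x * t)).
  by move=> cb b1; exact: integrable_transform.
have swap (b : R -> R) : continuous b -> (forall x, `|b x| <= 1) ->
    transform b (fun x => weight eps x * transform b h x) t =
    \int[mu]_s (h s * transform b (fun x => weight eps x * b (x * t)) s).
  move=> cb b1; rewrite -Rintegral_transformC ?iwb//.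
  by apply: eq_Rintegral => x _; rewrite mulrAC.
rewrite /smooth !swap//; [|exact: continuous_sin|exact: continuous_cos|exact: cos_max].
have i2 (b : R -> R) : continuous b -> (forall x, `|b x| <= 1) ->
    L1 (fun s => h s * transform b (fun x => weight eps x * b (x * t)) s).
  move=> cb b1; apply: (@integrable_mul_bounded _ _ _
    (\int[mu]_x `|weight eps x * b (x * t)|)) => //.
    by apply: continuous_measurable_fun; apply: continuous_transform => //; exact: iwb.
  by move=> x; apply: transform_bound => //; exact: iwb.
rewrite -RintegralD//; last 2 first.
- by apply: i2; [exact: continuous_cos|exact: cos_max].
- by apply: i2 => //; exact: continuous_sin.
apply: eq_Rintegral => s _; rewrite -mulrDr; congr (_ * _).
rewrite -transform_cos_weight// /transform -RintegralD//; last 2 first.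
- apply: integrable_transform; [exact: continuous_cos|exact: cos_max|].
  by apply: iwb; [exact: continuous_cos|exact: cos_max].
- by apply: integrable_transform; [exact: continuous_sin|exact: sin_max|];
    apply: iwb => //; exact: continuous_sin.
by apply: eq_Rintegral => x _; rewrite mulrBr cosB; ring.
Qed.

(** The identity behind Plancherel's theorem, damped by the weight so that
    every integral converges absolutely. *)
Lemma damped_plancherel eps g h : 0 < eps -> L1 g -> L1 h ->
  \int[mu]_x (weight eps x * (transform cos g x * transform cos h x +
                              transform sin g x * transform sin h x)) =
  \int[mu]_t (g t * smooth eps h t).
Proof.
move=> e0 ig ih.
have iwt (b : R -> R) : continuous b -> (forall x, `|b x| <= 1) ->
    L1 (fun x => weight eps x * transform b h x) by
  move=> cb b1; exact: integrable_weight_transform.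
have i1 (b : R -> R) : continuous b -> (forall x, `|b x| <= 1) ->
    L1 (fun x => weight eps x * transform b h x * transform b g x).
  move=> cb b1; apply: (@integrable_mul_bounded _ _ _ (\int[mu]_x `|g x|)).
  - exact: iwt.
  - by apply: continuous_measurable_fun; exact: continuous_transform.
  - by move=> x; exact: transform_bound.
have i2 (b : R -> R) : continuous b -> (forall x, `|b x| <= 1) ->
    L1 (fun t => g t * transform b (fun x => weight eps x * transform b h x) t).
  move=> cb b1.
  apply: (@integrable_mul_bounded _ _ _ (\int[mu]_x `|weight eps x * transform b h x|)) => //.
    by apply: continuous_measurable_fun; apply: continuous_transform => //; exact: iwt.
  by move=> x; apply: transform_bound => //; exact: iwt.
have cc := @continuous_cos R; have cs := @continuous_sin R; have c1 := @cos_max R.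
rewrite /smooth; under [RHS]eq_Rintegral do rewrite mulrDr.
rewrite RintegralD ?i2// -!(Rintegral_transformC _ _ (iwt _ _ _) ig)//.
rewrite -RintegralD ?i1//.
by apply: eq_Rintegral => x _; ring.
Qed.

End PoissonKernel.

Section WeakPlancherel.
Context {R : realType}.
Local Notation mu := (@lebesgue_measure R).
Local Notation L1 f := (mu.-integrable setT (EFin \o f)).
Implicit Types (eps u x t : R) (g h : R -> R).
Local Notation K eps u := (eps / (eps ^+ 2 + u ^+ 2)).

Lemma continuous_poisson eps t : 0 < eps -> continuous (fun s : R => K eps (t - s)).
Proof.
move=> e0 s; apply: cvgM; first exact: cvg_cst.
apply: cvgV; first by rewrite gt_eqF// ltr_pwDl ?exprn_gt0 ?sqr_ge0.
apply: cvgD; first exact: cvg_cst.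
by under eq_fun do rewrite expr2; apply: cvgM; (apply: cvgB; [exact: cvg_cst|exact: cvg_id]).
Qed.

Lemma integrable_itv (f : R -> R) a b : continuous f ->
  mu.-integrable `[a, b] (EFin \o f).
Proof.
move=> cf; apply: continuous_compact_integrable; first exact: segment_compact.
exact: continuous_subspaceT.
Qed.

Lemma integral_poisson eps t a b : 0 < eps -> a < b ->
  \int[mu]_(s in `[a, b]) K eps (t - s) = atan ((b - t) / eps) - atan ((a - t) / eps).
Proof.
move=> e0 ab.
have dA (s : R) : is_derive s 1 (fun s => atan ((s - t) / eps)) (K eps (t - s)).
  have h : is_derive s 1 (fun y => (y - t) / eps) eps^-1.
    apply: is_derive_ext (is_deriveZ eps^-1 (is_deriveB (is_derive_id s 1)
      (is_derive_cst t s 1))) _ _ => [y|].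
      by rewrite mulrC.
    by rewrite subr0 /GRing.scale /= mulr1.
  apply: is_derive_ext (is_derive1_comp (is_derive1_atan _) h) _ _ => //.
  field; rewrite ?gt_eqF//=.
  by rewrite ltr_pwDl ?exprn_gt0 ?sqr_ge0.
have cA := is_derive_continuous dA.
rewrite /Rintegral (@continuous_FTC2 _ _ (fun s => atan ((s - t) / eps)))//.
- by apply: continuous_subspaceT; exact: continuous_poisson.
- split=> [x _||]; first by have dx := dA x; exact: ex_derive.
  + exact/cvg_at_right_filter/cA.
  + exact/cvg_at_left_filter/cA.
- by move=> x _; rewrite derive1E; have dx := dA x; exact: derive_val.
Qed.

Lemma ae_neq (c : R) : {ae mu, forall t, t != c}.
Proof.
exists [set c]; split; [exact: measurable_set1|exact: lebesgue_measure_set1|].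
by move=> t /= /negP; rewrite negbK => /eqP.
Qed.

Lemma cvg_atan_scaled (c : R) : c != 0 ->
  atan (c / n.+1%:R^-1) @[n --> \oo] --> Num.sg c * (pi / 2).
Proof.
have pos (k : R) : 0 < k -> atan (k / n.+1%:R^-1) @[n --> \oo] --> pi / 2.
  move=> k0; under eq_fun do rewrite invrK.
  have ky : k * n.+1%:R @[n --> \oo] --> +oo.
    apply/cvgryPge => r; apply: filterS (nbhs_infty_ger (r / k)) => n rn.
    by rewrite mulrC -ler_pdivrMr// (le_trans rn)// ler_nat.
  by apply: cvg_comp ky _; exact: cvgy_atan.
have [c0 _|c0 _|] := ltgtP c 0; last by [].
  rewrite ltr0_sg// mulN1r (_ : (fun n => _) = (fun n => - atan (- c / n.+1%:R^-1))).
    by apply: cvgN; apply: pos; rewrite oppr_gt0.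
  by apply/funext => n; rewrite mulNr atanN opprK.
by rewrite gtr0_sg// mul1r; exact: pos.
Qed.

Variables (e : R -> R) (a b delta : R).
Hypotheses (ce : continuous e) (ab : a < b) (d0 : 0 < delta).
Hypothesis ed : forall s, a <= s <= b -> `|e s| <= delta.
Let h := e \_ `[a, b].

Let ih : L1 h.
Proof.
rewrite /h -restrict_EFin; apply/(integrable_mkcond _ _).1 => //.
exact: integrable_itv.
Qed.

Let hE s : s \in `[a, b] -> h s = e s.
Proof. by move=> sab; rewrite /h patchE mem_set. Qed.

Let h0 s : s \notin `[a, b] -> h s = 0.
Proof. by move=> sab; rewrite /h patchE memNset//; exact/negP. Qed.

Let hd s : `|h s| <= delta.
Proof.
have [sab|sab] := boolP (s \in `[a, b]); last by rewrite h0// normr0 ltW.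
by rewrite hE// ed//; rewrite in_itv in sab.
Qed.

Let smooth_itv eps t : 0 < eps ->
  smooth eps h t = \int[mu]_(s in `[a, b]) (e s * K eps (t - s)).
Proof.
move=> e0; rewrite smoothE// [RHS]Rintegral_mkcond.
by apply: eq_Rintegral => s _; rewrite /h !patchE; case: ifP; rewrite ?mul0r.
Qed.

Let iK eps t : 0 < eps -> mu.-integrable `[a, b] (EFin \o (fun s => K eps (t - s))).
Proof. by move=> e0; apply: integrable_itv; exact: continuous_poisson. Qed.

Let ifK (f : R -> R) eps t : 0 < eps -> continuous f ->
  mu.-integrable `[a, b] (EFin \o (fun s => f s * K eps (t - s))).
Proof.
move=> e0 cf; apply: integrable_itv => s; apply: cvgM; first exact: cf.
exact: continuous_poisson.
Qed.

Let K_ge0 eps u : 0 < eps -> 0 <= K eps u.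
Proof. by move=> e0; rewrite divr_ge0 ?addr_ge0 ?sqr_ge0// ltW. Qed.

Let A eps t := atan ((b - t) / eps) - atan ((a - t) / eps).

Let A_pi eps t : A eps t <= pi.
Proof.
have := atan_ltpi2 ((b - t) / eps); have := atan_gtNpi2 ((a - t) / eps).
by rewrite /A; lra.
Qed.

Let smooth_le eps t : 0 < eps -> `|smooth eps h t| <= delta * A eps t.
Proof.
move=> e0; rewrite smooth_itv// (le_trans (le_normr_Rintegral _ _))//.
  exact: ifK.
rewrite /A -(integral_poisson t e0 ab) -RintegralZl//; last exact: iK.
apply: le_Rintegral => //.
- by apply: integrable_norm; exact: ifK.
- exact: (ifK _ e0 (fun=> cvg_cst _)).
- move=> s; rewrite /= in_itv/= => sab.
  by rewrite normrM (ger0_norm (K_ge0 _ e0)) ler_wpM2r ?K_ge0// ed.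
Qed.

(** Near t the continuity of e makes the integrand small, and farther than rho
    from t the bound K(u) <= eps / u^2 does. *)
Let smooth_near t kappa : a < t < b -> 0 < kappa ->
  exists C, forall eps, 0 < eps ->
    `|smooth eps h t - e t * A eps t| <= kappa * pi + C * eps.
Proof.
move=> tab k0; have tab' : a <= t <= b by case/andP: tab => *; rewrite !ltW.
have [rho rho0 erho] : exists2 rho, 0 < rho & forall s, `|t - s| < rho -> `|e t - e s| < kappa.
  have cet : e x @[x --> t] --> e t := @ce t.
  have /cvgrPdist_lt/(_ _ k0)[rho /= rho0 hr] := cet.
  by exists rho.
exists (delta *+ 2 / rho ^+ 2 * (b - a)) => eps e0.
rewrite smooth_itv// /A -(integral_poisson t e0 ab) -RintegralZl//; last exact: iK.
rewrite -RintegralB//; [|exact: ifK|exact: (ifK _ e0 (fun=> cvg_cst _))].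
have cet : continuous (fun s => e s - e t).
  by move=> s; apply: cvgB; [exact: ce|exact: cvg_cst].
under eq_Rintegral do rewrite -mulrBl.
rewrite (le_trans (le_normr_Rintegral _ (ifK _ e0 cet)))//.
pose D := delta *+ 2 / rho ^+ 2.
have D0 : 0 <= D by rewrite divr_ge0 ?mulrn_wge0 ?sqr_ge0// ltW.
have i1 : mu.-integrable `[a, b] (EFin \o (fun s => kappa * K eps (t - s))).
  exact: (ifK _ e0 (fun=> cvg_cst _)).
have i2 : mu.-integrable `[a, b] (EFin \o (fun=> D * eps)).
  by apply: integrable_itv => s; exact: cvg_cst.
apply: (@le_trans _ _ (\int[mu]_(s in `[a, b]) (kappa * K eps (t - s) + D * eps))).
  apply: le_Rintegral => //.
  - by apply: integrable_norm; exact: ifK.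
  - apply: integrable_itv => s; apply: cvgD; last exact: cvg_cst.
    by apply: cvgM; [exact: cvg_cst|exact: continuous_poisson].
  - move=> s; rewrite /= in_itv/= => sab; rewrite normrM (ger0_norm (K_ge0 _ e0)).
    have [near|far] := ltrP `|t - s| rho.
      rewrite -[leLHS]addr0; apply: lerD; last by rewrite mulr_ge0// ltW.
      by rewrite ler_wpM2r ?K_ge0// distrC ltW// erho.
    rewrite -[leLHS]add0r; apply: lerD; first by rewrite mulr_ge0 ?K_ge0 ?(ltW k0).
    have q0 : 0 < eps ^+ 2 + (t - s) ^+ 2 by rewrite ltr_pwDl ?exprn_gt0 ?sqr_ge0.
    have rs : rho ^+ 2 <= (t - s) ^+ 2.
      by rewrite -(real_normK (num_real (t - s))) lerXn2r ?nnegrE// ltW.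
    rewrite mulrCA (mulrC D) ler_pM2l//.
    rewrite ler_pdivrMr// /D mulrAC ler_pdivlMr ?exprn_gt0//.
    rewrite ler_pM ?sqr_ge0//; last by rewrite (le_trans rs)// lerDr sqr_ge0.
    by rewrite (le_trans (ler_normB _ _))// mulr2n lerD// ed.
rewrite RintegralD// Rintegral_cst// RintegralZl//; last exact: iK.
rewrite integral_poisson// lerD//; first by rewrite ler_wpM2l ?A_pi// ltW.
by rewrite /= lebesgue_measure_itv/= lte_fin ab /= mulrAC.
Qed.

Let smooth_cvg t : t != a -> t != b ->
  smooth n.+1%:R^-1 h t @[n --> \oo] --> pi * h t.
Proof.
move=> ta tb.
have sA : A n.+1%:R^-1 t @[n --> \oo] -->
    Num.sg (b - t) * (pi / 2) - Num.sg (a - t) * (pi / 2).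
  by apply: cvgB; apply: cvg_atan_scaled; rewrite subr_eq0 eq_sym.
have [tab|tab] := boolP (t \in `[a, b]); last first.
  rewrite h0// mulr0; move: sA.
  have -> : Num.sg (b - t) * (pi / 2) - Num.sg (a - t) * (pi / 2) = 0.
    move: tab; rewrite in_itv/= negb_and -!ltNge => /orP[at_|bt].
      by rewrite !gtr0_sg ?subr_gt0 ?subrr// (lt_trans _ ab).
    by rewrite !ltr0_sg ?subr_lt0 ?subrr// (lt_trans ab).
  move=> A0; have dA0 : delta * A n.+1%:R^-1 t @[n --> \oo] --> 0.
    by rewrite -[0](mulr0 delta); apply: cvgM => //; exact: cvg_cst.
  apply: (@squeeze_cvgr _ _ _ _ (fun n => - (delta * A n.+1%:R^-1 t))
    (fun n => delta * A n.+1%:R^-1 t)) => //.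
    by apply: nearW => n; rewrite -ler_norml smooth_le.
  by rewrite -[0]oppr0; exact: cvgN.
have {}tab : a < t < b by move: tab; rewrite in_itv/= !le_eqVlt eq_sym (negbTE ta) (negbTE tb).
rewrite hE; last by rewrite in_itv/=; case/andP: tab => *; rewrite !ltW.
have {}sA : A n.+1%:R^-1 t @[n --> \oo] --> pi.
  suff -> : pi = Num.sg (b - t) * (pi / 2) - Num.sg (a - t) * (pi / 2) :> R by [].
  case/andP: tab => at_ tb_; rewrite gtr0_sg ?subr_gt0// ltr0_sg ?subr_lt0//.
  by field.
have -> : (fun n => smooth n.+1%:R^-1 h t) = (fun n => e t * A n.+1%:R^-1 t +
    (smooth n.+1%:R^-1 h t - e t * A n.+1%:R^-1 t)).
  by apply/funext => n; rewrite addrC subrK.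
rewrite -[pi * _]addr0 mulrC; apply: cvgD; first by apply: cvgM => //; exact: cvg_cst.
suff main (r : R) : 0 < r ->
    \forall n \near \oo, `|smooth n.+1%:R^-1 h t - e t * A n.+1%:R^-1 t| <= r.
  exact/cvgr0Pnorm_le.
move=> r0.
have k0 : 0 < r / (2 * pi) by rewrite divr_gt0 ?mulr_gt0 ?pi_gt0.
have [C hC] := smooth_near tab k0.
have r2 : 0 < r / 2 by rewrite divr_gt0.
have : C * n.+1%:R^-1 @[n --> \oo] --> 0.
  by rewrite -[0](mulr0 C); apply: cvgM; [exact: cvg_cst|exact: cvg_harmonic].
move=> /cvgr0Pnorm_le/(_ _ r2); apply: filterS => n hn.
rewrite (le_trans (hC _ _))//.
have pi0 : pi != 0 :> R by rewrite gt_eqF// pi_gt0.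
have -> : r / (2 * pi) * pi = r / 2 by rewrite invfM mulrA mulfVK.
by rewrite [leRHS]splitr lerD2l (le_trans (ler_norm _)).
Qed.

#[local] Hint Resolve sin_max : core.

Let energy g x := transform cos g x ^+ 2 + transform sin g x ^+ 2.

Let energy_ge0 g x : 0 <= energy g x.
Proof. by rewrite addr_ge0 ?sqr_ge0. Qed.

Let menergy g : L1 g -> measurable_fun setT (energy g).
Proof.
move=> ig; apply: measurable_funD; apply: measurable_funX; apply: measurable_transform => //.
- exact: continuous_cos.
- exact: cos_max.
- exact: continuous_sin.
Qed.

Let energy_bound g : L1 g -> exists M, forall x, `|energy g x| <= M.
Proof.
move=> ig; exists ((\int[mu]_x `|g x|) ^+ 2 *+ 2) => x.
rewrite ger0_norm// mulr2n; have N0 : 0 <= \int[mu]_x `|g x| by apply: Rintegral_ge0.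
have B (b0 : R -> R) : continuous b0 -> (forall x, `|b0 x| <= 1) ->
    transform b0 g x ^+ 2 <= (\int[mu]_x `|g x|) ^+ 2.
  move=> cb b1; rewrite -real_normK ?num_real// lerXn2r ?nnegrE//.
  exact: transform_bound.
by apply: lerD; apply: B => //; [exact: continuous_cos|exact: cos_max|exact: continuous_sin].
Qed.

Let iwenergy eps g : 0 < eps -> L1 g -> L1 (fun x => weight eps x * energy g x).
Proof.
move=> e0 ig; have [M hM] := energy_bound ig.
by apply: (integrable_mul_bounded _ (menergy ig) hM); exact: integrable_weight.
Qed.

Let damped_energy eps : 0 < eps ->
  \int[mu]_x (weight eps x * energy h x) <= delta ^+ 2 * pi * (b - a).
Proof.
move=> e0; have := damped_plancherel e0 ih ih.
under eq_Rintegral do rewrite -!expr2 -/(energy h _).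
move=> ->; have -> : \int[mu]_t (h t * smooth eps h t) =
    \int[mu]_(t in `[a, b]) (e t * smooth eps h t).
  rewrite [RHS]Rintegral_mkcond; apply: eq_Rintegral => t _.
  by rewrite /h !patchE; case: ifP; rewrite ?mul0r.
have -> : delta ^+ 2 * pi * (b - a) = \int[mu]_(t in `[a, b]) (delta ^+ 2 * pi).
  by rewrite Rintegral_cst//= lebesgue_measure_itv/= lte_fin ab.
apply: le_Rintegral => //.
- apply: integrable_itv => t; apply: cvgM; first exact: ce.
  exact: continuous_smooth.
- by apply: integrable_itv => t; exact: cvg_cst.
- move=> t; rewrite /= in_itv/= => tab.
  rewrite (le_trans (ler_norm _))// normrM expr2 -mulrA ler_pM ?ed//.
  by rewrite (le_trans (smooth_le _ e0))// ler_wpM2l ?A_pi// ltW.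
Qed.

(** Half of Plancherel's theorem, by duality.  By [damped_plancherel] the
    integral of F against the smoothing of h = e 1_[a,b] is a damped pairing of
    transforms; it is at most delta / 2 times the energy V of F plus
    1 / (2 delta) times the damped energy of h, which [damped_energy] bounds by
    delta^2 pi (b - a).  The damping is removed at the end, where the smoothing
    tends to pi h almost everywhere. *)
Lemma weak_plancherel (F : R -> R) (V : R) : L1 F ->
  (\int[mu]_x (transform cos F x ^+ 2 + transform sin F x ^+ 2)%:E <= V%:E)%E ->
  `|\int[mu]_(x in `[a, b]) (F x * e x)| <= delta * (V + (b - a)).
Proof.
move=> iF FV; have V0 : 0 <= V.
  by rewrite -lee_fin (le_trans _ FV)// integral_ge0// => x _; rewrite lee_fin energy_ge0.
have iE : L1 (energy F).
  apply/integrableP; split; first by apply/measurable_EFinP; exact: menergy.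
  under eq_integral do rewrite gee0_abs ?lee_fin ?energy_ge0//.
  exact: (le_lt_trans FV (ltry _)).
have EV : \int[mu]_x energy F x <= V.
  by rewrite -lee_fin fineK//; exact: integrable_fin_num.
have bound eps : 0 < eps ->
    `|\int[mu]_t (F t * smooth eps h t)| <= delta / 2 * (V + pi * (b - a)).
  move=> e0; rewrite -damped_plancherel//.
  pose G x := delta / 2 * energy F x + (2 * delta)^-1 * (weight eps x * energy h x).
  have iG : L1 G.
    have := integrableD measurableT (integrableZl measurableT (delta / 2) iE)
      (integrableZl measurableT (2 * delta)^-1 (iwenergy e0 ih)); exact.
  apply: (@le_trans _ _ (\int[mu]_x G x)); last first.
    rewrite RintegralD//; last 2 first.
    - by have := integrableZl measurableT (delta / 2) iE; exact.
    - by have := integrableZl measurableT (2 * delta)^-1 (iwenergy e0 ih); exact.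
    rewrite RintegralZl// RintegralZl//; last exact: iwenergy.
    rewrite mulrDr lerD//; first by rewrite ler_wpM2l// divr_ge0// ltW.
    have k0 : 0 <= (2 * delta)^-1 by rewrite invr_ge0 mulr_ge0// ltW.
    rewrite (le_trans (ler_wpM2l k0 (damped_energy e0)))//.
    suff -> : (2 * delta)^-1 * (delta ^+ 2 * pi * (b - a)) = delta / 2 * (pi * (b - a)) by [].
    by field; rewrite gt_eqF.
  have pw x : `|weight eps x * (transform cos F x * transform cos h x +
                     transform sin F x * transform sin h x)| <= G x.
    have w0 := weight_ge0 eps x; have w1 := weight_le1 x e0.
    rewrite /G /energy ler_norml.
    move: (weight eps x) (transform cos F x) (transform cos h x)
      (transform sin F x) (transform sin h x) w0 w1 => w p q r s w0 w1.
    have k (y z : R) : - (delta / 2 * y ^+ 2 + (2 * delta)^-1 * (w * z ^+ 2)) <= w * (y * z)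
      <= delta / 2 * y ^+ 2 + (2 * delta)^-1 * (w * z ^+ 2).
      have wy : w * (delta / 2 * y ^+ 2) <= delta / 2 * y ^+ 2.
        by rewrite ler_piMl// mulr_ge0 ?sqr_ge0// divr_ge0// ltW.
      have sq (z' : R) : w * (y * z') <=
          w * (delta / 2 * y ^+ 2) + (2 * delta)^-1 * (w * z' ^+ 2).
        rewrite -subr_ge0 (_ : _ - _ = w * ((2 * delta)^-1 * (delta * y - z') ^+ 2)).
          apply: mulr_ge0 => //; apply: mulr_ge0; last exact: sqr_ge0.
          by rewrite invr_ge0 mulr_ge0// ltW.
        by field; rewrite gt_eqF.
      by have := sq z; have := sq (- z); rewrite sqrrN !mulrN; lra.
    by have := k p q; have := k r s; lra.
  have mp : L1 (fun x => weight eps x * (transform cos F x * transform cos h x +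
                     transform sin F x * transform sin h x)).
    apply: le_integrable iG => //.
      apply/measurable_EFinP; apply: measurable_funM.
        by apply/measurable_EFinP; exact: (measurable_int mu (integrable_weight e0)).
      by apply: measurable_funD; apply: measurable_funM; apply: measurable_transform => //;
        exact: continuous_cos || exact: continuous_sin || exact: cos_max.
    by move=> x _ /=; rewrite lee_fin (le_trans (pw x))// ler_norm.
  rewrite (le_trans (le_normr_Rintegral _ mp))//; apply: le_Rintegral => //.
  exact: integrable_norm mp.
have e0 n : 0 < n.+1%:R^-1 :> R by [].
have iFs n : L1 (fun t => F t * smooth n.+1%:R^-1 h t).
  apply: (@integrable_mul_bounded _ _ _ (delta * pi)) => //.
    by apply: continuous_measurable_fun; exact: continuous_smooth.
  move=> t; rewrite (le_trans (smooth_le _ (e0 n)))// ler_wpM2l ?A_pi//.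
  exact: ltW.
have mF : measurable_fun setT F by apply/measurable_EFinP; exact: (measurable_int mu iF).
have mh : measurable_fun setT h by apply/measurable_EFinP; exact: (measurable_int mu ih).
have iFh : L1 (fun t => F t * h t) by exact: (integrable_mul_bounded iF mh hd).
have lim : \int[mu]_t (F t * smooth n.+1%:R^-1 h t) @[n --> \oo] -->
    pi * \int[mu]_t (F t * h t).
  rewrite -RintegralZl//; apply: fine_cvg; rewrite fineK; last first.
    apply: integrable_fin_num => //.
    by have := integrableZl measurableT pi iFh; exact.
  have [//|||||_ _] := @dominated_convergence _ _ _ mu setT measurableT
    (fun n t => (F t * smooth n.+1%:R^-1 h t)%:E)
    (fun t => (pi * (F t * h t))%:E) (fun t => (delta * pi * `|F t|)%:E).
  - by move=> n; exact: (measurable_int mu (iFs n)).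
  - by apply/measurable_EFinP; apply: measurable_funM => //; exact: measurable_funM.
  - have ae2 : {ae mu, forall t, t != a /\ t != b}.
      apply: negligibleS (negligibleU (ae_neq a) (ae_neq b)) => t /= h'.
      by apply/not_andP => -[ta tb]; apply: h'.
    apply: negligibleS ae2 => t /= + [ta tb]; apply => _.
    apply: cvg_EFin; first by apply: nearW.
    rewrite mulrCA; apply: cvgM; first exact: cvg_cst.
    exact: smooth_cvg.
  - by have := integrableZl measurableT (delta * pi) (integrable_norm iF); exact.
  - apply: aeW => t n _; rewrite /= lee_fin normrM mulrC ler_wpM2r//.
    by rewrite (le_trans (smooth_le _ (e0 n)))// ler_wpM2l ?A_pi// ltW.
  exact.
have -> : \int[mu]_(t in `[a, b]) (F t * e t) = \int[mu]_t (F t * h t).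
  rewrite Rintegral_mkcond; apply: eq_Rintegral => t _.
  by rewrite /h !patchE; case: ifP; rewrite ?mulr0.
have : `|pi * \int[mu]_t (F t * h t)| <= delta / 2 * (V + pi * (b - a)).
  apply: (cvgr_to_le (cvg_norm lim)); apply: nearW => n; exact: bound.
rewrite normrM (gtr0_norm (pi_gt0 _)).
have p2 := pi_ge2 R; rewrite -ler_pdivlMl ?pi_gt0// => /le_trans; apply.
rewrite ler_pdivrMl ?pi_gt0// mulrCA -mulrA ler_pM2l// mulrDr.
have ba : 0 < b - a by rewrite subr_gt0.
by nra.
Qed.

End WeakPlancherel.

(** * Fourier transforms of complex functions *)

Section FourierEnergy.
Context {R : realType}.
Local Notation mu := (@lebesgue_measure R).
Local Notation L1 f := (mu.-integrable setT (EFin \o f)).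
Local Open Scope complex_scope.
Implicit Types (F f : R -> R[i]).

Lemma normc_sqr (z : R[i]) :
  Normc.normc z ^+ 2 = complex.Re z ^+ 2 + complex.Im z ^+ 2.
Proof. by case: z => x y /=; rewrite sqr_sqrtr// addr_ge0 ?sqr_ge0. Qed.

Lemma integral_reflect (g : R -> R) : measurable_fun setT g ->
  (forall x, 0 <= g x) ->
  (\int[mu]_x (g (- x))%:E = \int[mu]_x (g x)%:E)%E.
Proof.
move=> mg g0.
have -> : (\int[mu]_x (g x)%:E =
    \int[pushforward mu (-%R : _ -> measurableTypeR R)]_x (g x)%:E)%E.
  by apply: eq_measure_integral => A mA _; exact/esym/lebesgue_measureN.
rewrite ge0_integral_pushforward//; first exact/measurable_EFinP.
by move=> x _; rewrite lee_fin.
Qed.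

Lemma L2norm_sqr F :
  (\int[mu]_x (complex.Re (F x) ^+ 2 + complex.Im (F x) ^+ 2)%:E =
    L2norm F `^ 2)%E.
Proof.
rewrite /L2norm poweR_Lnorm//; apply: eq_integral => x _.
have n0 : 0 <= Normc.normc (F x) by case: (F x) => p q; exact: sqrtr_ge0.
by rewrite -normc_sqr /= ger0_norm// -(@powR_mulrn _ _ 2).
Qed.

Lemma L2norm_energy F (C : R) : 0 <= C -> (L2norm F <= C%:E)%E ->
  (\int[mu]_x (complex.Re (F x) ^+ 2 + complex.Im (F x) ^+ 2)%:E <= (C ^+ 2)%:E)%E.
Proof.
move=> C0 FC; rewrite L2norm_sqr -(@powR_mulrn _ _ 2)// -poweR_EFin.
by apply: gt0_ler_poweR => //; rewrite in_itv/= ?leey ?andbT ?Lnorm_ge0.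
Qed.

(** |g| <= 1 + g^2, and 1 is integrable on a bounded set. *)
Lemma L2_integrable F : L2 F -> (exists M, forall t, M < `|t| -> F t = 0) ->
  L1 (fun t => complex.Re (F t)) /\ L1 (fun t => complex.Im (F t)).
Proof.
move=> [[mRe mIm] F2] [M FM].
pose E t := complex.Re (F t) ^+ 2 + complex.Im (F t) ^+ 2.
have iE : L1 E.
  apply/integrableP; split.
    by apply/measurable_EFinP; apply: measurable_funD; exact: measurable_funX.
  under eq_integral do rewrite gee0_abs ?lee_fin ?addr_ge0 ?sqr_ge0//.
  by rewrite /E L2norm_sqr poweR_lty.
have iG : L1 (fun t => \1_`[(- M), M] t + E t).
  have := integrableD measurableT (integrable_indic_itv (- M) M true false) iE; exact.
have H (g : R -> R) : measurable_fun setT g -> (forall t, g t ^+ 2 <= E t) ->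
    (forall t, F t = 0 -> g t = 0) -> L1 g.
  move=> mg gE g0; apply: le_integrable iG => //; first exact/measurable_EFinP.
  move=> t _; have E0 : 0 <= E t by rewrite addr_ge0 ?sqr_ge0.
  rewrite /= lee_fin (ger0_norm (addr_ge0 _ E0))//.
  have [tM|/FM/g0 ->] := leP `|t| M; last by rewrite normr0 addr_ge0.
  rewrite indicE mem_set/=; last by rewrite in_itv/= -ler_norml.
  rewrite (le_trans _ (lerD (lexx 1) (gE t)))// -real_normK ?num_real//.
  by have := sqr_ge0 (`|g t| - 1); nra.
split; apply: H => // t; rewrite ?lerDl ?lerDr ?sqr_ge0//; by move=> ->.
Qed.

Lemma fourierE F x : L1 (fun t => complex.Re (F t)) -> L1 (fun t => complex.Im (F t)) ->
  fourier F x =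
   (transform cos (fun t => complex.Re (F t)) x - transform sin (fun t => complex.Im (F t)) x) +i*
   (transform cos (fun t => complex.Im (F t)) x + transform sin (fun t => complex.Re (F t)) x).
Proof.
move=> iRe iIm; rewrite /fourier /integralC; congr (_ +i* _).
  rewrite -RintegralB//; [|apply: integrable_transform..] => //.
  - by apply: eq_Rintegral => t _; case: (F t) => p q /=; ring.
  - exact: continuous_cos.
  - exact: cos_max.
  - exact: continuous_sin.
  - exact: sin_max.
rewrite -RintegralD//; [|apply: integrable_transform..] => //.
- by apply: eq_Rintegral => t _; case: (F t) => p q /=; ring.
- exact: continuous_cos.
- exact: cos_max.
- exact: continuous_sin.
- exact: sin_max.
Qed.

(** The cosine transforms of the real and imaginary parts of F are even and
    their sine transforms are odd, so all four are read off the values of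
    fourier F at x and at - x. *)
Lemma transform_energy F (V : R) :
  L1 (fun t => complex.Re (F t)) -> L1 (fun t => complex.Im (F t)) ->
  (\int[mu]_x (complex.Re (fourier F x) ^+ 2 + complex.Im (fourier F x) ^+ 2)%:E <= V%:E)%E ->
  forall P, P = (fun t => complex.Re (F t)) \/ P = (fun t => complex.Im (F t)) ->
  (\int[mu]_x (transform cos P x ^+ 2 + transform sin P x ^+ 2)%:E <= V%:E)%E.
Proof.
move=> iRe iIm fV P hP.
pose E x := complex.Re (fourier F x) ^+ 2 + complex.Im (fourier F x) ^+ 2.
have iP : L1 P by case: hP => ->.
have cc := @continuous_cos R; have cs := @continuous_sin R.
have cm := @cos_max R; have sm := @sin_max R.
have mE : measurable_fun setT E.
  rewrite /E; under eq_fun do rewrite fourierE//=.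
  apply: measurable_funD; apply: measurable_funX.
    by apply: measurable_funB; exact: measurable_transform.
  by apply: measurable_funD; exact: measurable_transform.
have mEN : measurable_fun setT (fun x : R => E (- x)).
  by apply: (measurableT_comp mE); exact: oppr_measurable.
have E0 x : 0 <= E x by rewrite addr_ge0 ?sqr_ge0.
have PE x : transform cos P x ^+ 2 + transform sin P x ^+ 2 <= 2^-1 * (E x + E (- x)).
  have tN (g : R -> R) : transform cos g (- x) = transform cos g x.
    by apply: eq_Rintegral => t _; rewrite mulrN cosN.
  have tN' (g : R -> R) : L1 g -> transform sin g (- x) = - transform sin g x.
    move=> ig; rewrite -[RHS]mulN1r /transform -RintegralZl//; last exact: integrable_transform.
    by apply: eq_Rintegral => t _; rewrite mulrN sinN mulN1r mulrN.
  rewrite /E !fourierE//= !tN !tN'//.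
  by case: hP => ->; set p := transform _ _ _; set q := transform _ _ _;
    set r := transform _ _ _; set s := transform _ _ _; nra.
have -> : V%:E = (2^-1%:E * (V%:E + V%:E))%E.
  by rewrite -EFinD -EFinM; congr (_%:E); field.
apply: (@le_trans _ _ (\int[mu]_x (2^-1 * (E x + E (- x)))%:E)%E).
  apply: ge0_le_integral => //.
  - by move=> x _; rewrite lee_fin addr_ge0 ?sqr_ge0.
  - by apply/measurable_EFinP; apply: measurable_funD; apply: measurable_funX;
    exact: measurable_transform.
  - apply/measurable_EFinP; apply: measurable_funM => //; exact: measurable_funD.
  - by move=> x _; rewrite lee_fin.
under eq_integral do rewrite EFinM EFinD.
rewrite ge0_integralZl//; last 2 first.
- by apply: emeasurable_funD; exact/measurable_EFinP.
- by move=> x _; rewrite adde_ge0// lee_fin.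
rewrite ge0_integralD//; try exact/measurable_EFinP; try by move=> x _; rewrite lee_fin.
rewrite (integral_reflect mE E0) lee_pmul2l// ?lte_fin//.
exact: leeD.
Qed.

End FourierEnergy.

Section Pairing.
Context {R : realType}.
Local Notation mu := (@lebesgue_measure R).
Local Notation L1 f := (mu.-integrable setT (EFin \o f)).
Local Open Scope complex_scope.
Implicit Types (F g : R -> R[i]).

Definition ccontinuous g : Prop :=
  continuous (fun t => complex.Re (g t)) /\ continuous (fun t => complex.Im (g t)).

Lemma ccontinuous_cst (z : R[i]) : ccontinuous (fun=> z).
Proof. by split=> t; exact: cvg_cst. Qed.

Lemma ccontinuousD g1 g2 : ccontinuous g1 -> ccontinuous g2 ->
  ccontinuous (fun t => g1 t + g2 t).
Proof.
move=> [r1 i1] [r2 i2]; split=> t.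
  rewrite (_ : (fun _ => _) = (fun t => complex.Re (g1 t) + complex.Re (g2 t))).
    by apply: cvgD; [exact: r1|exact: r2].
  by apply/funext => s; case: (g1 s) (g2 s) => ? ? [].
rewrite (_ : (fun _ => _) = (fun t => complex.Im (g1 t) + complex.Im (g2 t))).
  by apply: cvgD; [exact: i1|exact: i2].
by apply/funext => s; case: (g1 s) (g2 s) => ? ? [].
Qed.

Lemma ccontinuousM g1 g2 : ccontinuous g1 -> ccontinuous g2 ->
  ccontinuous (fun t => g1 t * g2 t).
Proof.
move=> [r1 i1] [r2 i2]; split=> t.
  rewrite (_ : (fun _ => _) = (fun t => complex.Re (g1 t) * complex.Re (g2 t) -
      complex.Im (g1 t) * complex.Im (g2 t))).
    by apply: cvgB; apply: cvgM; by [exact: r1|exact: r2|exact: i1|exact: i2].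
  by apply/funext => s; case: (g1 s) (g2 s) => ? ? [].
rewrite (_ : (fun _ => _) = (fun t => complex.Re (g1 t) * complex.Im (g2 t) +
    complex.Im (g1 t) * complex.Re (g2 t))).
  by apply: cvgD; apply: cvgM; by [exact: r1|exact: r2|exact: i1|exact: i2].
by apply/funext => s; case: (g1 s) (g2 s) => ? ? [].
Qed.

Lemma ccontinuous_expi (u : R -> R) : continuous u -> ccontinuous (fun t => expi (u t)).
Proof.
move=> cu; split=> t /=; apply: continuous_comp; try exact: cu.
  exact: continuous_cos.
exact: continuous_sin.
Qed.

Lemma ccontinuousX g n : ccontinuous g -> ccontinuous (fun t => g t ^+ n).
Proof.
move=> cg; elim: n => [|n IH]; first exact: ccontinuous_cst.
by under eq_fun do rewrite exprS; exact: ccontinuousM.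
Qed.

Lemma ccontinuous_horner (p : {poly R[i]}) g : ccontinuous g ->
  ccontinuous (fun t => p.[g t]).
Proof.
move=> cg; elim/poly_ind: p => [|p c IH].
  by under eq_fun do rewrite horner0; exact: ccontinuous_cst.
under eq_fun do rewrite hornerMXaddC.
by apply: ccontinuousD; [exact: ccontinuousM|exact: ccontinuous_cst].
Qed.

Lemma integrable_mul_continuous (P q : R -> R) a b : L1 P -> continuous q ->
  mu.-integrable `[a, b] (EFin \o (fun t => P t * q t)).
Proof.
move=> iP cq.
have iP' : mu.-integrable `[a, b] (EFin \o P) by exact: integrableS iP.
have [M hM] : exists M, forall t, t \in `[a, b] -> `|q t| <= M.
  have [ab|ba] := leP a b; last first.
    by exists 0 => t; rewrite in_itv/= => /andP[/le_trans/[apply]]; rewrite leNgt ba.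
  have cn : {within `[a, b], continuous (fun t => `|q t|)}.
    by apply: continuous_subspaceT => t; apply: (@cvg_norm _ _ _ (nbhs t)); exact: cq.
  by have [c _ hc] := EVT_max ab cn; exists `|q c| => t; exact: hc.
have mP : measurable_fun setT P by apply/measurable_EFinP; exact: (measurable_int mu iP).
have iMP : mu.-integrable `[a, b] (fun t => (M%:E * (P t)%:E)%E).
  exact: integrableZl.
apply: le_integrable iMP => //.
  apply/measurable_EFinP; apply: measurable_funTS; apply: measurable_funM => //.
  exact: continuous_measurable_fun.
move=> t tab; rewrite /= lee_fin !normrM mulrC ler_wpM2r//.
by rewrite (le_trans (hM t tab))// ler_norm.
Qed.

Definition pairing a b F g : R[i] :=
  (\int[mu]_(t in `[a, b]) complex.Re (F t * g t)) +i*
  (\int[mu]_(t in `[a, b]) complex.Im (F t * g t)).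

Lemma complex_ReM (z w : R[i]) : complex.Re (z * w) =
  complex.Re z * complex.Re w - complex.Im z * complex.Im w.
Proof. by case: z w => ? ? []. Qed.

Lemma complex_ImM (z w : R[i]) : complex.Im (z * w) =
  complex.Re z * complex.Im w + complex.Im z * complex.Re w.
Proof. by case: z w => ? ? []. Qed.

Section FixedF.
Variables (a b : R) (F : R -> R[i]).
Hypothesis iRe : L1 (fun t => complex.Re (F t)).
Hypothesis iIm : L1 (fun t => complex.Im (F t)).

Let iReg g : ccontinuous g -> 
  mu.-integrable `[a, b] (EFin \o (fun t => complex.Re (F t * g t))).
Proof.
move=> [cr ci]; rewrite (_ : (fun t => complex.Re (F t * g t)) = (fun t =>
    complex.Re (F t) * complex.Re (g t) - complex.Im (F t) * complex.Im (g t))).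
2: by apply/funext => t; rewrite complex_ReM.
exact: (integrableB _ (integrable_mul_continuous a b iRe cr)
   (integrable_mul_continuous a b iIm ci)).
Qed.

Let iImg g : ccontinuous g -> 
  mu.-integrable `[a, b] (EFin \o (fun t => complex.Im (F t * g t))).
Proof.
move=> [cr ci]; rewrite (_ : (fun t => complex.Im (F t * g t)) = (fun t =>
    complex.Re (F t) * complex.Im (g t) + complex.Im (F t) * complex.Re (g t))).
2: by apply/funext => t; rewrite complex_ImM.
exact: (integrableD _ (integrable_mul_continuous a b iRe ci)
   (integrable_mul_continuous a b iIm cr)).
Qed.

Lemma pairingD g1 g2 : ccontinuous g1 -> ccontinuous g2 ->
  pairing a b F (fun t => g1 t + g2 t) = pairing a b F g1 + pairing a b F g2.
Proof.
move=> c1 c2; rewrite /pairing; simpc; rewrite -!RintegralD//; try by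
  [exact: iReg|exact: iImg].
by congr (_ +i* _); apply: eq_Rintegral => t _; rewrite mulrDr raddfD.
Qed.

Lemma pairingZ (c : R[i]) g : ccontinuous g ->
  pairing a b F (fun t => c * g t) = c * pairing a b F g.
Proof.
move=> cg; case: c => p q; rewrite /pairing; simpc; rewrite -!RintegralZl//; try by
  [exact: iReg|exact: iImg].
have iZ (k : R) (G : R -> R) : mu.-integrable `[a, b] (EFin \o G) ->
    mu.-integrable `[a, b] (EFin \o (fun t => k * G t)).
  move=> iG; suff: mu.-integrable `[a, b] (fun t => (k%:E * (G t)%:E)%E) by [].
  exact: integrableZl.
have {}iR := iReg cg; have {}iI := iImg cg.
congr (_ +i* _); [rewrite -RintegralB//|rewrite -RintegralD//]; try exact: iZ;
  by apply: eq_Rintegral => t _; case: (F t) (g t) => ? ? [? ?] /=; ring.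
Qed.

Lemma pairing_sum (I : finType) (c : I -> R[i]) (g : I -> R -> R[i]) :
  (forall i, ccontinuous (g i)) ->
  pairing a b F (fun t => \sum_i c i * g i t) = \sum_i c i * pairing a b F (g i).
Proof.
move=> cg.
suff H (s : seq I) : ccontinuous (fun t => \sum_(i <- s) c i * g i t) /\
    pairing a b F (fun t => \sum_(i <- s) c i * g i t) = \sum_(i <- s) c i * pairing a b F (g i).
  exact: (H _).2.
elim: s => [|i s [IH1 IH2]].
  under eq_fun do rewrite big_nil; split; first exact: ccontinuous_cst.
  rewrite big_nil /pairing; under eq_Rintegral do rewrite mulr0 /=.
  rewrite Rintegral_cst// mul0r; congr (_ +i* _).
  by under eq_Rintegral do rewrite mulr0 /=; rewrite Rintegral_cst// mul0r.
have ci : ccontinuous (fun t => c i * g i t).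
  by apply: ccontinuousM => //; exact: ccontinuous_cst.
under eq_fun do rewrite big_cons; split; first exact: ccontinuousD.
by rewrite pairingD// pairingZ// IH2 big_cons.
Qed.

(** The four real products making up F g are controlled by [weak_plancherel];
    hence the factor 4. *)
Lemma pairing_bound g (delta V : R) : a < b -> 0 < delta -> ccontinuous g ->
  (forall t, a <= t <= b -> Normc.normc (g t) <= delta) ->
  (\int[mu]_x (complex.Re (fourier F x) ^+ 2 + complex.Im (fourier F x) ^+ 2)%:E <= V%:E)%E ->
  Normc.normc (pairing a b F g) <= 4 * (delta * (V + (b - a))).
Proof.
move=> ab d0 [cr ci] gd FV.
have normc_Re (z : R[i]) : `|complex.Re z| <= Normc.normc z.
  case: z => x y /=; rewrite -sqrtr_sqr ler_wsqrtr// lerDl sqr_ge0 //.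
have normc_Im (z : R[i]) : `|complex.Im z| <= Normc.normc z.
  case: z => x y /=; rewrite -sqrtr_sqr ler_wsqrtr// lerDr sqr_ge0 //.
have rd t : a <= t <= b -> `|complex.Re (g t)| <= delta.
  by move=> /gd; exact: le_trans.
have id t : a <= t <= b -> `|complex.Im (g t)| <= delta.
  by move=> /gd; exact: le_trans.
have ER := transform_energy iRe iIm FV (or_introl erefl).
have EI := transform_energy iRe iIm FV (or_intror erefl).
have h1 := weak_plancherel cr ab d0 rd iRe ER.
have h2 := weak_plancherel ci ab d0 id iIm EI.
have h3 := weak_plancherel ci ab d0 id iRe ER.
have h4 := weak_plancherel cr ab d0 rd iIm EI.
rewrite (le_trans (normc_le_ReIm _ _))//.
under eq_Rintegral do rewrite complex_ReM.
rewrite RintegralB//; try exact: integrable_mul_continuous.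
under [X in _ + `|X|]eq_Rintegral do rewrite complex_ImM.
rewrite RintegralD//; try exact: integrable_mul_continuous.
have k1 := ler_normB (\int[mu]_(t in `[a, b]) (complex.Re (F t) * complex.Re (g t)))
  (\int[mu]_(t in `[a, b]) (complex.Im (F t) * complex.Im (g t))).
have k2 := ler_normD (\int[mu]_(t in `[a, b]) (complex.Re (F t) * complex.Im (g t)))
  (\int[mu]_(t in `[a, b]) (complex.Im (F t) * complex.Re (g t))).
rewrite (le_trans (lerD k1 k2))//.
rewrite (_ : 4 * _ = delta * (V + (b - a)) + delta * (V + (b - a)) +
  (delta * (V + (b - a)) + delta * (V + (b - a)))); last by ring.
by rewrite !lerD.
Qed.

End FixedF.
End Pairing.

(** * Rank of a family of values of Fourier transforms *)

Section LocalCount.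
Context {R : realType}.
Local Notation mu := (@lebesgue_measure R).
Local Notation L1 f := (mu.-integrable setT (EFin \o f)).
Local Open Scope complex_scope.

Lemma Rintegral_cells (N : nat) (c : 'I_N -> R) (w : R) (G : R -> R) : L1 G ->
  (forall t, G t != 0 -> exists j, c j <= t < c j + w) ->
  (forall i j t, c i <= t < c i + w -> c j <= t < c j + w -> i = j) ->
  \int[mu]_t G t = \sum_j \int[mu]_(t in `[c j, c j + w]) G t.
Proof.
move=> iG cov dis.
have iGj j : L1 (G \_ `[c j, (c j + w)[).
  rewrite -restrict_EFin; apply/(integrable_mkcond _ _).1 => //.
  exact: integrableS iG.
transitivity (\sum_j \int[mu]_t (G \_ `[c j, (c j + w)[) t); last first.
  apply: eq_bigr => j _; rewrite -Rintegral_mkcond Rintegral_itv_bndo_bndc//.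
  exact: integrableS iG.
rewrite /Rintegral sum_fine; last by move=> j _; exact: integrable_fin_num (iGj j).
congr fine; rewrite -integral_sum//.
apply: eq_integral => t _; rewrite sumEFin; congr (_%:E).
have [Gt|Gt] := eqVneq (G t) 0.
  by rewrite Gt big1// => j _; rewrite patchE Gt if_same.
have [j jt] := cov t Gt.
rewrite (bigD1 j)//= big1 ?addr0; first by rewrite patchE mem_set.
move=> i ij; rewrite patchE ifF//; apply/negbTE/negP => /set_mem/= it.
by move/eqP: ij; apply; apply: (dis i j t); rewrite ?in_itv// in it.
Qed.

Lemma fourier_cells (N : nat) (c : 'I_N -> R) (w : R) (F : R -> R[i]) (x : R) :
  L1 (fun t => complex.Re (F t)) -> L1 (fun t => complex.Im (F t)) ->
  (forall t, F t != 0 -> exists j, c j <= t < c j + w) ->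
  (forall i j t, c i <= t < c i + w -> c j <= t < c j + w -> i = j) ->
  fourier F x = \sum_j pairing (c j) (c j + w) F (fun t => expi (t * x)).
Proof.
move=> iRe iIm cov dis.
have iE (P : R -> R) : L1 P ->
    L1 (fun t => P t * cos (t * x)) /\ L1 (fun t => P t * sin (t * x)).
  by move=> iP; split; apply: integrable_transform => //;
    [exact: continuous_cos|exact: cos_max|exact: continuous_sin|exact: sin_max].
have [iRc iRs] := iE _ iRe; have [iIc iIs] := iE _ iIm.
rewrite /pairing sum_complex /fourier /integralC; congr (_ +i* _).
  rewrite -Rintegral_cells//.
  - by apply: eq_Rintegral => t _; rewrite mulrC.
  - rewrite (_ : (fun _ => _) = (fun t => complex.Re (F t) * cos (t * x) -
      complex.Im (F t) * sin (t * x))); last by apply/funext => t; rewrite complex_ReM.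
    exact: (integrableB measurableT iRc iIs).
  - by move=> t /eqP Ft; apply: cov; apply/eqP => F0; apply: Ft; rewrite F0 mul0r.
rewrite -Rintegral_cells//.
- by apply: eq_Rintegral => t _; rewrite mulrC.
- rewrite (_ : (fun _ => _) = (fun t => complex.Re (F t) * sin (t * x) +
    complex.Im (F t) * cos (t * x))); last by apply/funext => t; rewrite complex_ImM.
  exact: (integrableD measurableT iRs iIc).
- by move=> t /eqP Ft; apply: cov; apply/eqP => F0; apply: Ft; rewrite F0 mul0r.
Qed.

Lemma normc_sqr_triangle (k : R) (z w : R[i]) : 0 < k ->
  Normc.normc (z + w) ^+ 2 <=
    (1 + k) * Normc.normc z ^+ 2 + (1 + k^-1) * Normc.normc w ^+ 2.
Proof.
move=> k0; rewrite !normc_sqr.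
have H (x y : R) : (x + y) ^+ 2 <= (1 + k) * x ^+ 2 + (1 + k^-1) * y ^+ 2.
  rewrite -subr_ge0 (_ : _ - _ = k^-1 * (k * x - y) ^+ 2).
    by rewrite mulr_ge0 ?sqr_ge0// invr_ge0 ltW.
  by field; rewrite gt_eqF.
case: z w => [x1 y1] [x2 y2] /=; have := H x1 x2; have := H y1 y2; lra.
Qed.

(** The bound of [exp_approx_error], with q in place of hav a. *)
Definition approx_error (M : nat) (q : R) : R := 32 * pi * (M%:R ^+ 2 + 4) * q ^+ M.

(** The map u sends the cell to [-a, a].  Up to a factor that does not depend on
    t and one that does not depend on x, e^(itx) is e^(isu) with
    0 <= s <= r w / (2 a), as x runs over a window of length r.  With
    s = m - 1 + theta and 1 <= theta < 2, this is e^(-iu) times the power z^m of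
    z = e^(iu) times e^(i theta u), which [exp_poly] approximates.  Since a can
    be chosen close to pi, each cell costs about r w / (2 pi) dimensions. *)
Lemma exp_cell_approx (cj w alpha r x a q : R) (M : nat) :
  0 < w -> 0 < a -> a < pi -> hav a <= q -> 0 < r ->
  alpha < x < alpha + r ->
  let u t := 2 * a / w * (t - (cj + w / 2)) in
  exists2 p : {poly R[i]}, (size p <= Num.truncn (r * w / (2 * a))%R + M.*2.+1)%N &
    forall t, cj <= t <= cj + w ->
    Normc.normc (expi (t * x) - expi (u t * (alpha * w / (2 * a) - 1 - M%:R)) * p.[expi (u t)])
      <= approx_error M q.
Proof.
move=> w0 a0 api qa r0 xr u.
pose s := (x - alpha) * w / (2 * a).
have a20 : 0 < 2 * a by rewrite mulr_gt0.
have s0 : 0 <= s.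
  by rewrite divr_ge0 ?mulr_ge0 ?subr_ge0 ?ltW//; case/andP: xr.
have sr : s <= r * w / (2 * a).
  by rewrite ler_pM2r ?invr_gt0// ler_pM2r//; case/andP: xr; lra.
pose m := Num.truncn s.
have /andP[ms sm] := truncn_itv s0.
pose theta := s - m%:R + 1.
have th : 1 <= theta <= 2.
  by rewrite /theta /m; move: sm; rewrite -natr1; lra.
exists ((expi ((cj + w / 2) * x))%:P * ('X^m * exp_poly theta M)).
  rewrite mul_polyC (leq_trans (size_scale_leq _ _))// (leq_trans (size_polyMleq _ _))//.
  rewrite size_polyXn addSn /= leq_add ?size_exp_poly//.
  exact: le_truncn.
move=> t tj; have ua : `|u t| <= a.
  have tw : `|t - (cj + w / 2)| <= w / 2 by rewrite ler_norml; lra.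
  have k0 : 0 <= 2 * a / w by rewrite divr_ge0 ?(ltW w0) ?(ltW a20).
  rewrite /u normrM (ger0_norm k0) (le_trans (ler_wpM2l k0 tw))//.
  by rewrite [leLHS](_ : _ = a)//; field; rewrite gt_eqF.
rewrite hornerM hornerC hornerM hornerXn.
have -> : expi (t * x) = expi ((cj + w / 2) * x) * expi (u t * (alpha * w / (2 * a) - 1)) *
    expi (u t) ^+ m * expi (theta * u t).
  rewrite -expiMn -!expiD; congr expi; rewrite /u /theta /s.
  by field; rewrite !gt_eqF.
have -> : expi (u t * (alpha * w / (2 * a) - 1 - M%:R)) =
   expi (u t * (alpha * w / (2 * a) - 1)) * expi (- (M%:R * u t)).
  by rewrite -expiD; congr expi; ring.
set A := expi (_ * x); set B := expi (u t * _); set P := (exp_poly theta M).[_].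
have -> : A * B * expi (u t) ^+ m * expi (theta * u t) -
    B * expi (- (M%:R * u t)) * (A * (expi (u t) ^+ m * P)) =
    A * B * expi (u t) ^+ m * (expi (theta * u t) - expi (- (M%:R * u t)) * P) by ring.
rewrite !Normc.normcM -expiMn !normc_expi !mul1r.
rewrite (le_trans (exp_approx_error M th api ua))// /approx_error.
have h0 : 0 <= hav a by rewrite divr_ge0// subr_ge0 cos_le1.
apply: ler_wpM2l; last by rewrite lerXn2r ?nnegrE// (le_trans h0).
by rewrite mulr_ge0 ?addr_ge0 ?exprn_ge0// mulr_ge0// pi_ge0.
Qed.

End LocalCount.

Section CountBound.
Context {R : realType}.
Local Notation mu := (@lebesgue_measure R).
Local Notation L1 f := (mu.-integrable setT (EFin \o f)).
Local Open Scope complex_scope.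

Variables (N : nat) (c : 'I_N -> R) (w : R).
Hypothesis w0 : 0 < w.
Hypothesis dis : forall i j t, c i <= t < c i + w -> c j <= t < c j + w -> i = j.

Lemma PW_fourier_rep (S : set R) (f : R -> R[i]) (V : R) : bounded_set S ->
  (forall t, S t -> exists j, c j <= t < c j + w) -> PW S f ->
  (\int[mu]_x (complex.Re (f x) ^+ 2 + complex.Im (f x) ^+ 2)%:E <= V%:E)%E ->
  exists F : R -> R[i],
    [/\ L1 (fun t => complex.Re (F t)), L1 (fun t => complex.Im (F t)),
        forall t, F t != 0 -> exists j, c j <= t < c j + w,
        f =1 fourier F &
        (\int[mu]_x (complex.Re (fourier F x) ^+ 2 +
                     complex.Im (fourier F x) ^+ 2)%:E <= V%:E)%E].
Proof.
move=> bS Scov [_ [F [F2 F0 fF]]] fV.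
have [M SM] : exists M, forall t, S t -> `|t| <= M.
  have [M [_ hM]] := bS; exists (M + 1) => t St; apply: (hM (M + 1)) => //.
  by rewrite ltrDl.
have [iRe iIm] : L1 (fun t => complex.Re (F t)) /\ L1 (fun t => complex.Im (F t)).
  apply: L2_integrable F2 _; exists M => t tM; apply: F0 => /SM.
  by rewrite leNgt tM.
exists F; split => //.
  move=> t Ft; apply: Scov; apply: contrapT => /F0 F0t.
  by rewrite F0t eqxx in Ft.
rewrite (_ : fourier F = f)//; exact/funext.
Qed.

Lemma normc_sum_le (I : finType) (z : I -> R[i]) :
  Normc.normc (\sum_i z i) <= \sum_i Normc.normc (z i).
Proof.
rewrite -lecR rmorph_sum; exact: (ler_norm_sum (index_enum I) z xpredT).
Qed.

(** Replacing every exponential by its polynomial approximation on every cell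
    turns the matrix (fourier (F i) (l j)) into a product X Y whose inner
    dimension is N cells times D coefficients, and moves each entry by at most
    tau.  Then [card_le_rank_of_rows_near_delta] applies to X Y; the parameter k
    weighs the two errors of a row against each other. *)
Lemma count_bound (n M : nat) (l : 'I_n -> R) (F : 'I_n -> R -> R[i])
    (alpha r a q d k V : R) :
  0 < a -> a < pi -> 0 < q -> hav a <= q -> 0 < r -> 0 <= d -> 0 < k -> 0 <= V ->
  (forall i, L1 (fun t => complex.Re (F i t))) ->
  (forall i, L1 (fun t => complex.Im (F i t))) ->
  (forall i t, F i t != 0 -> exists j, c j <= t < c j + w) ->
  (forall i, (\int[mu]_x (complex.Re (fourier (F i) x) ^+ 2 +
                     complex.Im (fourier (F i) x) ^+ 2)%:E <= V%:E)%E) ->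
  (forall i, alpha < l i < alpha + r) ->
  (forall i, \sum_j Normc.normc (fourier (F i) (l j) - (i == j)%:R) ^+ 2 <= d ^+ 2) ->
  n%:R * (1 - ((1 + k) * d ^+ 2 + (1 + k^-1) *
    (n%:R * (N%:R * (4 * (approx_error M q * (V + w)))) ^+ 2)))
    <= (N * (Num.truncn (r * w / (2 * a))%R + M.*2.+1))%:R.
Proof.
move=> a0 api q0 qa r0 d0 k0 V0 iRe iIm cov EV lr rows.
set D := (_ + M.*2.+1)%N; set tau := N%:R * _.
pose u j t := 2 * a / w * (t - (c j + w / 2)).
pose b := alpha * w / (2 * a) - 1 - M%:R.
have [p pD pe] : exists2 p : 'I_N -> 'I_n -> {poly R[i]},
    forall j i, (size (p j i) <= D)%N &
    forall j i t, c j <= t <= c j + w ->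
      Normc.normc (expi (t * l i) - expi (u j t * b) * (p j i).[expi (u j t)]) <= approx_error M q.
  have ex (ji : 'I_N * 'I_n) := exp_cell_approx (c ji.1) M w0 a0 api qa r0 (lr ji.2).
  have /choice[p hp] : forall ji : 'I_N * 'I_n, exists p : {poly R[i]}, (size p <= D)%N /\
    forall t, c ji.1 <= t <= c ji.1 + w ->
      Normc.normc (expi (t * l ji.2) - expi (u ji.1 t * b) * p.[expi (u ji.1 t)])
        <= approx_error M q.
    by move=> ji; have [p p1 p2] := ex ji; exists p.
  by exists (fun j i => p (j, i)) => j i; [exact: (hp (j, i)).1|exact: (hp (j, i)).2].
pose X (i : 'I_n) (jk : 'I_N * 'I_D) :=
  pairing (c jk.1) (c jk.1 + w) (F i) (fun t => expi (u jk.1 t * b) * expi (u jk.1 t) ^+ jk.2).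
pose Y (jk : 'I_N * 'I_D) (i : 'I_n) := (p jk.1 i)`_jk.2.
have -> : ((N * D)%:R : R) = #|{: 'I_N * 'I_D}|%:R by rewrite card_prod !card_ord.
have cu j : ccontinuous (fun t => expi (u j t)).
  apply: ccontinuous_expi => t; apply: cvgM; first exact: cvg_cst.
  by apply: cvgB; [exact: cvg_id|exact: cvg_cst].
have cub j : ccontinuous (fun t => expi (u j t * b)).
  apply: ccontinuous_expi => t; apply: cvgM; last exact: cvg_cst.
  apply: cvgM; first exact: cvg_cst.
  by apply: cvgB; [exact: cvg_id|exact: cvg_cst].
have cx x : ccontinuous (fun t : R => expi (t * x)).
  by apply: ccontinuous_expi; exact: mulrr_continuous.
have err0 : 0 < approx_error M q.
  by rewrite /approx_error !mulr_gt0 ?exprn_gt0 ?pi_gt0// ltr_wpDl ?exprn_ge0.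
have XY i j : \sum_jk X i jk * Y jk j =
    \sum_m pairing (c m) (c m + w) (F i) (fun t => expi (u m t * b) * (p m j).[expi (u m t)]).
  rewrite (eq_bigr (fun jk : 'I_N * 'I_D => X i (jk.1, jk.2) * Y (jk.1, jk.2) j)); last by case.
  rewrite -(pair_bigA _ (fun m k' => X i (m, k') * Y (m, k') j)) /=.
  apply: eq_bigr => m _.
  rewrite (_ : (fun t => _) = (fun t => \sum_(k' < D) (p m j)`_k' *
      (expi (u m t * b) * expi (u m t) ^+ k'))); last first.
    apply/funext => t; rewrite (horner_coef_wide _ (pD m j)) mulr_sumr.
    by apply: eq_bigr => k' _; rewrite mulrCA.
  rewrite pairing_sum//; first by apply: eq_bigr => k' _; rewrite mulrC.
  by move=> k'; apply: ccontinuousM => //; exact: ccontinuousX.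
have close i j : Normc.normc (\sum_jk X i jk * Y jk j - fourier (F i) (l j)) <= tau.
  rewrite XY (fourier_cells _ (iRe i) (iIm i) (cov i) dis) -sumrB.
  rewrite (le_trans (normc_sum_le _))//.
  have -> : tau = \sum_(m < N) 4 * (approx_error M q * (V + w)).
    by rewrite /tau sumr_const card_ord mulr_natl.
  apply: ler_sum => m _.
  have cE : ccontinuous (fun t => expi (u m t * b) * (p m j).[expi (u m t)]).
    by apply: ccontinuousM => //; exact: ccontinuous_horner.
  have cNE : ccontinuous (fun t => -1 * (expi (u m t * b) * (p m j).[expi (u m t)])).
    by apply: ccontinuousM => //; exact: ccontinuous_cst.
  have normcN (z : R[i]) : Normc.normc (- z) = Normc.normc z.
    by case: z => x y /=; rewrite !sqrrN.
  rewrite -normcN opprB -[X in _ - X]mul1r -mulNr -pairingZ// -pairingD//.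
  have cw : c m < c m + w by rewrite ltrDl.
  have cD : ccontinuous (fun t => expi (t * l j) +
    -1 * (expi (u m t * b) * (p m j).[expi (u m t)])) by exact: ccontinuousD.
  have := pairing_bound (iRe i) (iIm i) cw err0 cD _ (EV i).
  rewrite [c m + w - _]addrAC subrr add0r; apply => t tm.
  by rewrite mulN1r; exact: pe.
apply: (card_le_rank_of_rows_near_delta (X := X) (Y := Y)).
  rewrite addr_ge0// mulr_ge0 ?sqr_ge0// ?addr_ge0 ?invr_ge0 ?(ltW k0)//.
  by rewrite mulr_ge0 ?sqr_ge0.
move=> i; apply: (@le_trans _ _ (\sum_j ((1 + k) *
      Normc.normc (fourier (F i) (l j) - (i == j)%:R) ^+ 2 +
    (1 + k^-1) * tau ^+ 2))).
  apply: ler_sum => j _.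
  rewrite (_ : _ - _ = (fourier (F i) (l j) - (i == j)%:R) + 
     (\sum_jk X i jk * Y jk j - fourier (F i) (l j))); last by ring.
  rewrite (le_trans (normc_sqr_triangle _ _ k0))// lerD2l.
  rewrite ler_wpM2l ?addr_ge0 ?invr_ge0 ?(ltW k0)//.
  have n0 (z : R[i]) : 0 <= Normc.normc z by case: z => ? ?; exact: sqrtr_ge0.
  by rewrite lerXn2r ?nnegrE// (le_trans _ (close i j)).
rewrite big_split /= -mulr_sumr sumr_const card_ord -[X in _ + X <= _]mulr_natl mulrCA lerD2r.
by rewrite ler_wpM2l// addr_ge0// ltW.
Qed.

End CountBound.

(** * Coverings and counting *)

Section CellCover.
Context {R : realType}.
Local Notation mu := (@lebesgue_measure R).

Lemma compact_open_margin (S U : set R) : compact S -> open U -> S `<=` U ->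
  exists2 w : R, 0 < w & forall x y, S x -> `|x - y| < w -> U y.
Proof.
move=> /compact_near_coveringP cS oU SU.
have := cS _ (0^'+) (fun w x => forall y, `|x - y| < w -> U y) _.
case=> [x Sx|w /= w0 hw].
  have /nbhs_ballP[e /= e0 eU] : nbhs x U by apply: open_nbhs_nbhs; split => //; exact: SU.
  exists (ball x (e / 2), [set w | w < e / 2]) => /=.
    split; first by apply: nbhsx_ballx; rewrite divr_gt0.
    by apply: nbhs_right_lt; rewrite divr_gt0.
  move=> [x' w] /= [xx' we] y x'y; apply: eU.
  apply: (@ball_splitr _ _ x'); first exact: ball_sym.
  by rewrite /ball/= distrC (lt_trans _ we)// distrC.
exists (w / 2); first by rewrite divr_gt0.
move=> x y Sx; apply: (hw (w / 2)) => //=.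
  by rewrite sub0r normrN gtr0_norm ?divr_gt0// ltr_pdivrMr// ltr_pMr// ltr1n.
by rewrite divr_gt0.
Qed.

Lemma lebesgue_measure_compact_lty (S : set R) : compact S -> (mu S < +oo)%E.
Proof.
move=> cS; have [M [_ hM]] := compact_bounded cS.
have SM : S `<=` `[- (M + 1), M + 1].
  by move=> t /(hM (M + 1)); rewrite /= in_itv/= -ler_norml; apply; rewrite ltrDl.
apply: (@le_lt_trans _ _ (mu `[- (M + 1), M + 1])); last first.
  by rewrite lebesgue_measure_itv/=; case: ifP => _; exact: ltry.
by apply: le_measure => //; rewrite inE//; exact: compact_measurable.
Qed.

(** Take the cells of a grid that meet S, so fine that they stay in an open
    neighbourhood of S of nearly the same measure. *)
Lemma compact_cell_cover (S : set R) (e : R) : compact S -> 0 < e ->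
  exists N (c : 'I_N -> R) (w : R),
    [/\ 0 < w, forall t, S t -> exists j, c j <= t < c j + w,
        forall i j t, c i <= t < c i + w -> c j <= t < c j + w -> i = j &
        ((N%:R * w)%:E <= mu S + e%:E)%E].
Proof.
move=> cS e0; have mS := compact_measurable cS.
have Sfin := lebesgue_measure_compact_lty cS.
have [U [oU SU Ue]] := lebesgue_regularity_outer mS Sfin e0.
have [w w0 wU] := compact_open_margin cS oU SU.
have [M [_ hM]] := compact_bounded cS.
have SM t : S t -> `|t| <= M + 1 by apply: hM; rewrite ltrDl.
pose M1 := M + 1; pose b (k : nat) := - M1 + k%:R * w.
pose K := (Num.truncn (2 * M1 / w)).+1.
pose J := [set k : 'I_K | `[< exists2 t, S t & b k <= t < b k + w >]]%SET.
pose c (j : 'I_#|J|) := b (enum_val j).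
have bdis (k k' : nat) t : b k <= t < b k + w -> b k' <= t < b k' + w -> k = k'.
  rewrite /b => /andP[k1 k2] /andP[k1' k2'].
  have lt1 (x y : nat) : x%:R * w < y%:R * w + w -> (x <= y)%N.
    by rewrite -[X in _ + X]mul1r -mulrDl ltr_pM2r// natr1 ltr_nat.
  by apply/eqP; rewrite eqn_leq !lt1//; lra.
have dis i j t : c i <= t < c i + w -> c j <= t < c j + w -> i = j.
  by move=> it jt; apply/enum_val_inj/val_inj; exact: bdis it jt.
exists #|J|, c, w; split=> //.
- move=> t St; have := SM t St; rewrite ler_norml -/M1 => /andP[t1 t2].
  have s0 : 0 <= (t + M1) / w by rewrite divr_ge0 ?(ltW w0)//; lra.
  have /andP[ks sk] := truncn_itv s0.
  set k := Num.truncn _ in ks sk.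
  have kK : (k < K)%N.
    by rewrite ltnS; apply: le_truncn; rewrite ler_pM2r ?invr_gt0//; lra.
  have kt : b k <= t < b k + w.
    move: ks sk; rewrite ler_pdivlMr// ltr_pdivrMr// -natr1 mulrDl mul1r /b.
    by move=> *; apply/andP; split; lra.
  have kJ : Ordinal kK \in J by rewrite inE; apply/asboolP; exists t.
  by exists (enum_rank_in kJ (Ordinal kK)); rewrite /c enum_rankK_in.
- pose A (j : 'I_#|J|) := `[c j, (c j + w)[%classic.
  have AU : \big[setU/set0]_j A j `<=` U.
    elim/big_ind: _ => [//|X Y hX hY s [/hX|/hY]//|j _ s].
    rewrite /A /= in_itv/= => js; have := enum_valP j; rewrite inE => /asboolP[t St jt].
    apply: (wU t) => //; move: js jt; rewrite /c => /andP[? ?] /andP[? ?].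
    by rewrite ltr_norml; apply/andP; split; lra.
  have mA j : measurable (A j) by exact: measurable_itv.
  have mAw j : mu (A j) = w%:E.
    by rewrite /A lebesgue_measure_itv/= lte_fin ltrDl w0 -EFinB addrAC subrr add0r.
  have tA : trivIset setT A.
    apply/trivIsetP => i j _ _ ij; apply/seteqP; split=> // t [].
    by rewrite /A /= !in_itv/= => it jt; move/eqP: ij; apply; exact: dis it jt.
  have -> : ((#|J|%:R * w)%:E = mu (\big[setU/set0]_j A j))%E.
    transitivity (\sum_(j < #|J|) mu (A j))%E; last exact/esym/measure_bigsetU_ord.
    by under eq_bigr do rewrite mAw; rewrite sumEFin sumr_const card_ord mulr_natl.
  have mU := open_measurable oU.
  apply: (@le_trans _ _ (mu U)).
    apply: le_measure => //; rewrite inE//.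
    by apply: bigsetU_measurable => j _; exact: mA.
  rewrite -[in leLHS](setDUK SU) (le_trans (measureU2 _ _ _))//.
    exact: measurableD.
  by rewrite leeD2l// ltW.
Qed.

End CellCover.

Section Points.
Context {R : realType}.
Implicit Types (Lam A : set R).

Lemma uniformly_discrete_gap Lam : uniformly_discrete Lam ->
  exists2 g : R, 0 < g & forall x y, Lam x -> Lam y -> x != y -> g <= `|x - y|.
Proof.
rewrite /uniformly_discrete; set E := [set _ | _] => i0.
have [g g0 gi] : exists2 g : R, 0 < g & (g%:E <= ereal_inf E)%E.
  case: (ereal_inf E) i0 => [r| |]//; last by exists 1; rewrite ?leey.
  by rewrite lte_fin => r0; exists r.
exists g => // x y Lx Ly xy; rewrite -lee_fin (le_trans gi)//.
by apply: ereal_inf_lbound; exists x, y; split.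
Qed.

(** Points at distance at least g from each other have distinct integer parts
    after division by g. *)
Lemma card_window (n : nat) (l : 'I_n -> R) (g alpha r : R) : 0 < g ->
  (forall i j, i != j -> g <= `|l i - l j|) ->
  (forall i, alpha < l i < alpha + r) -> (n <= (Num.truncn (r / g)).+1)%N.
Proof.
move=> g0 gl lr.
have s0 i : 0 <= (l i - alpha) / g.
  by rewrite divr_ge0 ?(ltW g0)// subr_ge0 ltW//; case/andP: (lr i).
have kT i : (Num.truncn ((l i - alpha) / g) < (Num.truncn (r / g)).+1)%N.
  rewrite ltnS; apply: le_truncn; rewrite ler_pM2r ?invr_gt0//.
  by case/andP: (lr i); lra.
have inj : injective (fun i => Ordinal (kT i)).
  move=> i j /(congr1 val) /= ij; apply/eqP; apply: contraT => /gl.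
  have /andP[] := truncn_itv (s0 i); have /andP[] := truncn_itv (s0 j).
  rewrite ij -natr1 => a1 a2 b1 b2; rewrite leNgt => /negP[].
  have : `|(l i - alpha) / g - (l j - alpha) / g| < 1.
    by rewrite ltr_norml; apply/andP; split; lra.
  by rewrite -mulrBl opprB addrA subrK normrM normfV (gtr0_norm g0) ltr_pdivrMr// mul1r.
by have := leq_card _ inj; rewrite !card_ord.
Qed.

Lemma fset_enum_inj (X : {fset R}) :
  injective (fun i : 'I_#|` X| => tnth (in_tuple (enum_fset X)) i).
Proof. by apply/tuple_uniqP; exact: fset_uniq. Qed.

Lemma counting_enum A (B : nat) :
  (forall n (l : 'I_n -> R), injective l -> (forall i, A (l i)) -> (n <= B)%N) ->
  exists n (l : 'I_n -> R),
    [/\ injective l, forall i, A (l i) & (counting A = n%:R%:E :> \bar R)%E].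
Proof.
move=> AB.
have memA (X : {fset R}) : [set` X] `<=` A ->
    forall i : 'I_#|` X|, A (tnth (in_tuple (enum_fset X)) i).
  by move=> XA i; apply: XA; exact: mem_tnth.
have finA : finite_set A.
  apply: contrapT => /(infinite_set_fset B.+1)[X XA].
  by rewrite leqNgt ltnS (AB _ _ (@fset_enum_inj X) (memA X XA)).
exists #|` fset_set A|, (fun i => tnth (in_tuple (enum_fset (fset_set A))) i); split.
- exact: fset_enum_inj.
- by apply: memA; rewrite fset_setK.
- by rewrite /counting; case: ifPn => // /asboolP.
Qed.

Lemma l2norm_finite Lam (v : R -> R[i]) (d : R) n (l : 'I_n -> R) : 0 <= d ->
  (l2norm Lam v <= d%:E)%E -> injective l -> (forall i, Lam (l i)) ->
  \sum_j Normc.normc (v (l j)) ^+ 2 <= d ^+ 2.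
Proof.
move=> d0 vd linj lL.
have e0 : (0 <= \esum_(x in Lam) (Normc.normc (v x) ^+ 2)%:E)%E.
  by apply: esum_ge0 => x _; rewrite lee_fin sqr_ge0.
have ed : (\esum_(x in Lam) (Normc.normc (v x) ^+ 2)%:E <= (d ^+ 2)%:E)%E.
  have -> : (\esum_(x in Lam) (Normc.normc (v x) ^+ 2)%:E = l2norm Lam v `^ 2)%E.
    by rewrite /l2norm -poweRrM mulVf// poweRe1.
  rewrite -(@powR_mulrn _ _ 2)// -poweR_EFin.
  by apply: gt0_ler_poweR => //; rewrite in_itv/= ?leey ?andbT ?poweR_ge0.
rewrite -lee_fin (le_trans _ ed)//; apply: esum_ge.
pose s := [seq l j | j <- enum 'I_n].
exists [set` s].
  by split; [exact: finite_seq|move=> x /= /mapP[j _ ->]].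
rewrite -fsbig_seq; last by rewrite map_inj_uniq ?enum_uniq.
by rewrite big_map big_enum/= sumEFin.
Qed.

End Points.

(** * The density inequality *)

Section GeometricDecay.
Context {R : realType}.

Lemma bernoulli_ge (y : R) (n : nat) : 0 <= y -> 1 + n%:R * y <= (1 + y) ^+ n.
Proof.
move=> y0; elim: n => [|n IH]; first by rewrite mul0r addr0.
rewrite exprS (le_trans _ (ler_wpM2l _ IH)) ?addr_ge0// -natr1.
have ny2 : 0 <= n%:R * y ^+ 2 by rewrite mulr_ge0 ?sqr_ge0.
by lra.
Qed.

Lemma poly_geometric_bounded (p : R) : 0 < p -> p < 1 ->
  exists C, forall n : nat, n.+1%:R * p ^+ n <= C.
Proof.
move=> p0 p1; pose y := p^-1 - 1; have y0 : 0 < y by rewrite subr_gt0 invf_gt1.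
exists (1 + y^-1) => n; have := bernoulli_ge n (ltW y0).
have -> : 1 + y = p^-1 by rewrite /y addrC subrK.
rewrite exprVn => h.
have pn : 0 < p ^+ n by rewrite exprn_gt0.
rewrite -ler_pdivlMr// (le_trans _ (ler_wpM2l _ h))//; last first.
  by rewrite addr_ge0// invr_ge0 ltW.
have -> : (1 + y^-1) * (1 + n%:R * y) = 1 + n%:R * y + y^-1 + n%:R.
  by field; rewrite gt_eqF.
rewrite -natr1.
have yi : 0 < y^-1 by rewrite invr_gt0.
have ny : 0 <= n%:R * y by rewrite mulr_ge0// ltW.
by lra.
Qed.

(** Bounding q by p^6 leaves five factors p^n to absorb the polynomial and one
    to tend to 0. *)
Lemma poly_geometric_small (q C e : R) : 0 < q -> q < 1 -> 0 < e -> 0 <= C ->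
  \forall n \near \oo, C * n.+1%:R ^+ 5 * q ^+ n <= e.
Proof.
move=> q0 q1 e0 C0; pose p := 1 - (1 - q) / 6.
have p0 : 0 < p by rewrite /p; lra.
have p1 : p < 1 by rewrite /p; lra.
have qp : q <= p ^+ 6.
  have : forall n : nat, (n <= 6)%N -> 1 - n%:R * ((1 - q) / 6) <= p ^+ n.
    elim=> [|n IH] n6; first by rewrite mul0r subr0.
    rewrite exprS (le_trans _ (ler_wpM2l (ltW p0) (IH (ltnW n6))))// -natr1 /p.
    have : 0 <= n%:R * ((1 - q) / 6) ^+ 2 by rewrite mulr_ge0 ?sqr_ge0.
    by lra.
  by move=> /(_ 6 isT); apply: le_trans; lra.
have [K hK] := poly_geometric_bounded p0 p1.
have K0 : 0 <= K by rewrite (le_trans _ (hK 0))// mulr_ge0 ?exprn_ge0// ltW.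
have lim : C * K ^+ 5 * p ^+ n @[n --> \oo] --> 0.
  rewrite -[0](mulr0 (C * K ^+ 5)); apply: cvgM; first exact: cvg_cst.
  by apply: cvg_expr; rewrite ger0_norm// ltW.
move: lim => /cvgr0Pnorm_le/(_ _ e0); apply: filterS => n.
rewrite ger0_norm ?mulr_ge0 ?exprn_ge0 ?(ltW p0)//; apply: le_trans.
rewrite -[leLHS]mulrA -[leRHS]mulrA ler_wpM2l//.
apply: (@le_trans _ _ (n.+1%:R ^+ 5 * (p ^+ 6) ^+ n)).
  apply: ler_wpM2l; first by rewrite exprn_ge0.
  by rewrite lerXn2r ?nnegrE ?exprn_ge0 ?(ltW q0) ?(ltW p0).
rewrite -exprM mulnC (_ : n * 6 = n * 5 + n)%N; last by rewrite (mulnS n 5) addnC.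
rewrite exprD mulrA exprM -exprMn; apply: ler_wpM2r; first by rewrite exprn_ge0 ?(ltW p0).
by rewrite lerXn2r ?nnegrE// mulr_ge0 ?exprn_ge0 ?(ltW p0).
Qed.

End GeometricDecay.

Section DensityBound.
Context {R : realType}.
Local Notation mu := (@lebesgue_measure R).
Local Open Scope complex_scope.

Variables (S Lam : set R) (f : R -> R -> R[i]) (d : R).
Hypotheses (d0 : 0 < d) (d1 : d < 1) (cS : compact S) (udL : uniformly_discrete Lam).
Hypothesis fPW : forall xi, Lam xi -> PW S (f xi).
Hypothesis fsup : (ereal_sup [set L2norm (f xi) | xi in Lam] < +oo)%E.
Hypothesis fd : forall xi, Lam xi ->
  (l2norm Lam (fun l => (f xi l - delta xi l)%R) <= d%:E)%E.

Let energy_bound : exists2 V : R, 0 <= V & forall xi, Lam xi ->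
  (\int[mu]_x (complex.Re (f xi x) ^+ 2 + complex.Im (f xi x) ^+ 2)%:E <= V%:E)%E.
Proof.
have [C C0 fC] : exists2 C : R, 0 <= C & forall xi, Lam xi -> (L2norm (f xi) <= C%:E)%E.
  have ub xi : Lam xi -> (L2norm (f xi) <= ereal_sup [set L2norm (f xi) | xi in Lam])%E.
    by move=> L; apply: ereal_sup_ubound; exists xi.
  case: (ereal_sup _) fsup ub => [s _ ub|//|_ ub].
    exists (Num.max s 0) => [|xi /ub/le_trans]; first by rewrite le_max lexx orbT.
    by apply; rewrite lee_fin le_max lexx.
  by exists 0 => // xi /ub/le_trans; apply; rewrite leNye.
exists (C ^+ 2) => [|xi /fC]; first exact: sqr_ge0.
exact: L2norm_energy.
Qed.

(** [count_bound] for a long window.  The error is split into six parts of size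
    e / 6: the measure of the cells in excess of mu S, the factor pi / a = 1 + t,
    the N polynomials of size about 2 M with M about kap r, the integer parts,
    the factor 1 + k of the triangle inequality, and the approximation error
    tau, which decays geometrically in M and so beats n <= 2 r / g. *)
Lemma window_card (e : R) : 0 < e -> \forall r \near +oo,
  forall (alpha : R) n (l : 'I_n -> R), injective l -> (forall i, Lam (l i)) ->
  (forall i, alpha < l i < alpha + r) ->
  n%:R * (1 - d ^+ 2) <= r / (2 * pi) * (fine (mu S) + e).
Proof.
move=> e0; have [V V0 fV] := energy_bound.
have [g g0 gL] := uniformly_discrete_gap udL.
have e6 : 0 < e / 6 by rewrite divr_gt0.
have [N [c [w [w0 Scov dis NwS]]]] := compact_cell_cover cS e6.
have Sfin : mu S \is a fin_num.
  by rewrite ge0_fin_numE ?measure_ge0//; exact: lebesgue_measure_compact_lty.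
have {}NwS : N%:R * w <= fine (mu S) + e / 6.
  by rewrite -lee_fin EFinD fineK.
have bS := compact_bounded cS.
have Nw0 : 0 <= N%:R * w by rewrite mulr_ge0// ltW.
have pi0 : 0 < pi :> R := pi_gt0 R.
pose t := e / 6 / (N%:R * w + 1).
have t0 : 0 < t by rewrite divr_gt0// ltr_wpDl.
have tNw : N%:R * w * t <= e / 6.
  rewrite /t mulrCA ler_piMr ?(ltW e6)// ler_pdivrMr ?mul1r ?lerDl//.
  by rewrite ltr_wpDl.
pose a := pi / (1 + t).
have t1 : 0 < 1 + t by rewrite addr_gt0.
have a0 : 0 < a by rewrite divr_gt0.
have api : a < pi by rewrite ltr_pdivrMr// ltr_pMr// ltrDl.
have hav1 : hav a < 1.
  rewrite /hav ltr_pdivrMr// mul1r.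
  suff : -1 < cos a by lra.
  by rewrite -cospi ltr_cos ?in_itv/= ?lexx ?(ltW pi0) ?(ltW a0) ?(ltW api).
have hav0 : 0 <= hav a by rewrite divr_ge0// subr_ge0 cos_le1.
pose q := (1 + hav a) / 2.
have q0 : 0 < q by rewrite /q; lra.
have q1 : q < 1 by rewrite /q; lra.
have qa : hav a <= q by rewrite /q; lra.
pose kap := e / (24 * pi * (N%:R + 1)).
have N1 : 0 < N%:R + 1 :> R by rewrite ltr_wpDl.
have kap0 : 0 < kap by rewrite divr_gt0 // mulr_gt0 // mulr_gt0.
pose k := e * g / (24 * pi).
have k0 : 0 < k by rewrite divr_gt0 // mulr_gt0.
have ki0 : 0 < 1 + k^-1 by rewrite addr_gt0 ?invr_gt0.
pose eta := e * g / (24 * pi * (1 + k^-1)).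
have eta0 : 0 < eta by rewrite divr_gt0 // ?mulr_gt0 // mulr_gt0.
pose A := N%:R * (4 * (32 * pi * (V + w))).
have A0 : 0 <= A.
  by rewrite mulr_ge0// mulr_ge0// mulr_ge0 ?(addr_ge0 V0 (ltW w0))// mulr_ge0// ltW.
(* C is the constant in n tau^2 <= C (M + 1)^5 q^M: n is at most
   (2 / g / kap) (M + 1), and tau^2 at most A^2 16 (M + 1)^4 q^M. *)
pose C := 2 / g / kap * (16 * A ^+ 2).
have C0 : 0 <= C.
  by rewrite mulr_ge0 ?(mulr_ge0 _ (sqr_ge0 A))// divr_ge0 ?(ltW kap0)// divr_ge0// ltW.
have [M0 _ hM0] := poly_geometric_small q0 q1 eta0 C0.
near=> r.
have r0 : 0 < r by near: r; apply: nbhs_pinfty_gt; exact: num_real.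
have rg : g <= r by near: r; apply: nbhs_pinfty_ge; exact: num_real.
have rN : 12 * pi * N%:R / e <= r by near: r; apply: nbhs_pinfty_ge; exact: num_real.
have rM : M0.+1%:R / kap <= r by near: r; apply: nbhs_pinfty_ge; exact: num_real.
move=> alpha n l linj lL lr.
pose M := Num.truncn (kap * r).
have /andP[M_le M_gt] := truncn_itv (ltW (mulr_gt0 kap0 r0)).
rewrite -/M in M_le M_gt.
have MM0 : (M0 <= M)%N.
  rewrite -ltnS -(ltr_nat R) (le_lt_trans _ M_gt)//.
  rewrite (le_trans _ (_ : M0.+1%:R <= _)) ?ler_nat//.
  by rewrite mulrC -ler_pdivrMr.
have nr : n%:R <= 2 * r / g.
  have gl i j : i != j -> g <= `|l i - l j|.
    by move=> ij; apply: gL => //; apply: contraNneq ij => /linj ->.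
  have nT := card_window g0 gl lr.
  have T : (Num.truncn (r / g))%:R <= r / g by rewrite truncn_le divr_ge0 ?ltW.
  have rg1 : 1 <= r / g by rewrite ler_pdivlMr// mul1r.
  have : n%:R <= (Num.truncn (r / g)).+1%:R :> R by rewrite ler_nat.
  by rewrite -natr1 -mulrA; lra.
set tau := N%:R * (4 * (approx_error M q * (V + w))).
have ntau : n%:R * tau ^+ 2 <= eta.
  apply: (le_trans _ (hM0 M MM0)).
  have -> : tau = A * ((M%:R ^+ 2 + 4) * q ^+ M).
    by rewrite /tau /A /approx_error; ring.
  rewrite exprMn /C.
  have m0 : 0 <= M%:R :> R by [].
  have qM : (q ^+ M) ^+ 2 <= q ^+ M.
    by rewrite expr2 ler_piMl ?exprn_ge0 ?exprn_ile1 ?(ltW q0) ?(ltW q1).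
  have s1 : ((M%:R ^+ 2 + 4) * q ^+ M) ^+ 2 <= 16 * M.+1%:R ^+ 4 * q ^+ M.
    rewrite exprMn ler_pM ?sqr_ge0//.
    have -> : 16 * M.+1%:R ^+ 4 = (4 * M.+1%:R ^+ 2) ^+ 2 :> R by ring.
    rewrite lerXn2r ?nnegrE ?addr_ge0 ?mulr_ge0 ?exprn_ge0 ?sqr_ge0//.
    have -> : M.+1%:R = M%:R + 1 :> R by rewrite natr1.
    by move: (M%:R) m0 => m m0; have := sqr_ge0 m; lra.
  have s2 : n%:R <= 2 / g / kap * M.+1%:R.
    rewrite (le_trans nr)// [leLHS](_ : _ = 2 / g / kap * (kap * r)); last first.
      by field; rewrite !gt_eqF.
    apply: ler_wpM2l; last exact: ltW.
    by rewrite divr_ge0 ?(ltW kap0)// divr_ge0// ltW.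
  rewrite (le_trans (ler_pM _ _ s2 (ler_wpM2l (sqr_ge0 A) s1)))//.
    by rewrite mulr_ge0 ?sqr_ge0.
  by rewrite le_eqVlt; apply/orP; left; apply/eqP; ring.
have /choice[FF hFF] : forall i, exists F : R -> R[i],
    [/\ mu.-integrable setT (EFin \o (fun t => complex.Re (F t))),
        mu.-integrable setT (EFin \o (fun t => complex.Im (F t))),
        forall t, F t != 0 -> exists j, c j <= t < c j + w,
        f (l i) =1 fourier F &
        (\int[mu]_x (complex.Re (fourier F x) ^+ 2 +
                     complex.Im (fourier F x) ^+ 2)%:E <= V%:E)%E].
  by move=> i; exact: (PW_fourier_rep bS Scov (fPW (lL i)) (fV _ (lL i))).
have rows i : \sum_j Normc.normc (fourier (FF i) (l j) - (i == j)%:R) ^+ 2 <= d ^+ 2.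
  have [_ _ _ fE _] := hFF i.
  have := l2norm_finite (ltW d0) (fd (lL i)) linj lL; apply: le_trans.
  by apply: ler_sum => j _; rewrite fE /delta (inj_eq linj) eq_sym.
have i1 i : mu.-integrable setT (EFin \o (fun t => complex.Re (FF i t))) by case: (hFF i).
have i2 i : mu.-integrable setT (EFin \o (fun t => complex.Im (FF i t))) by case: (hFF i).
have i3 i t' : FF i t' != 0 -> exists j, c j <= t' < c j + w by case: (hFF i) => _ _ + _ _; apply.
have i4 i : (\int[mu]_x (complex.Re (fourier (FF i) x) ^+ 2 +
    complex.Im (fourier (FF i) x) ^+ 2)%:E <= V%:E)%E by case: (hFF i).
have main := count_bound w0 dis M a0 api q0 qa r0 (ltW d0) k0 V0 i1 i2 i3 i4 lr rows.
rewrite -/tau in main.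
have rhs : (N * (Num.truncn (r * w / (2 * a))%R + M.*2.+1))%:R <=
    N%:R * (r * w / (2 * a) + (2 * (kap * r) + 1)) :> R.
  rewrite natrM ler_wpM2l// natrD -[M.*2.+1%:R]natr1 -mul2n natrM.
  rewrite lerD ?lerD2r ?ler_wpM2l// truncn_le divr_ge0 ?(mulr_ge0 (ltW r0) (ltW w0))//.
  by rewrite mulr_ge0// ltW.
have {main rhs} main := le_trans main rhs.
pose rho := r / (2 * pi).
have rho0 : 0 < rho by rewrite divr_gt0// mulr_gt0.
have n0 : 0 <= n%:R :> R by [].
have h1 : n%:R * (k * d ^+ 2) <= rho * (e / 6).
  apply: (@le_trans _ _ (2 * r / g * (k * 1))).
    apply: ler_pM => //; first by rewrite mulr_ge0 ?sqr_ge0// ltW.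
    by rewrite ler_pM2l// expr_le1// ltW.
  rewrite le_eqVlt; apply/orP; left; apply/eqP; rewrite /k /rho.
  by move: (@pi R) pi0 => P P0; field; rewrite !gt_eqF.
have h2 : n%:R * ((1 + k^-1) * (n%:R * tau ^+ 2)) <= rho * (e / 6).
  apply: (@le_trans _ _ (2 * r / g * ((1 + k^-1) * eta))).
    apply: ler_pM => //; last by rewrite ler_pM2l.
    by rewrite mulr_ge0 ?(ltW ki0)// mulr_ge0 ?sqr_ge0.
  rewrite le_eqVlt; apply/orP; left; apply/eqP; rewrite /eta /rho.
  by move: (@pi R) pi0 => P P0; field; rewrite !gt_eqF//=; rewrite addr_gt0.
have h3 : N%:R * (r * w / (2 * a)) = rho * (N%:R * w * (1 + t)).
  by rewrite /rho /a; move: (@pi R) pi0 => P P0; field; rewrite !gt_eqF.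
have h4 : N%:R * (2 * (kap * r)) <= rho * (e / 6).
  apply: (@le_trans _ _ ((N%:R + 1) * (2 * (kap * r)))).
    apply: ler_wpM2r; last by rewrite lerDl.
    by rewrite mulr_ge0// mulr_ge0// ltW.
  rewrite le_eqVlt; apply/orP; left; apply/eqP; rewrite /kap /rho.
  by move: (@pi R) pi0 => P P0; field; rewrite !gt_eqF.
have h5 : N%:R <= rho * (e / 6).
  move: rN; rewrite ler_pdivrMr// => rN.
  rewrite /rho [leRHS](_ : _ = r * e / (12 * pi)); last first.
    by move: (@pi R) pi0 => P P0; field; rewrite gt_eqF.
  by rewrite ler_pdivlMr ?mulr_gt0// mulrC.
have h6 : rho * (N%:R * w * (1 + t) + 4 * (e / 6)) <= rho * (fine (mu S) + e).
  rewrite ler_pM2l//; lra.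
rewrite (le_trans _ h6)//.
rewrite -/rho in main *.
lra.
Unshelve. all: by end_near.
Qed.

Lemma window_density (e : R) : 0 < e -> \forall r \near +oo,
  (ereal_sup [set (counting (Lam `&` `]a, (a + r)%R[) * (r^-1)%R%:E)%E
              | a in [set: R]] <= ((2 * pi * (1 - d ^+ 2))^-1 * (fine (mu S) + e))%:E)%E.
Proof.
move=> e0; have [g g0 gL] := uniformly_discrete_gap udL.
have dd : 0 < 1 - d ^+ 2 by rewrite subr_gt0 expr_lt1// ltW.
near=> r.
have r0 : 0 < r by near: r; apply: nbhs_pinfty_gt; exact: num_real.
apply: ge_ereal_sup => _ [a _ <-].
have win n (l : 'I_n -> R) : injective l -> (forall i, (Lam `&` `]a, (a + r)[) (l i)) ->
    (n <= (Num.truncn (r / g)).+1)%N.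
  move=> linj lL; apply: (card_window (l := l) (alpha := a)) => // [i j ij|i].
    by apply: gL; [case: (lL i)|case: (lL j)|apply: contraNneq ij => /linj ->].
  by case: (lL i) => _ /=; rewrite in_itv.
have [n [l [linj lL ->]]] := counting_enum win.
have nb : n%:R * (1 - d ^+ 2) <= r / (2 * pi) * (fine (mu S) + e).
  have l1 i : Lam (l i) by case: (lL i).
  have l2 i : a < l i < a + r by case: (lL i) => _ /=; rewrite in_itv.
  move: a n l linj l1 l2 {win lL}; near: r; exact: window_card.
rewrite -EFinM lee_fin ler_pdivrMr// -ler_pdivlMr// in nb *.
rewrite (le_trans nb)// le_eqVlt; apply/orP; left; apply/eqP.
have p0 := pi_gt0 R; move: (@pi R) p0 => P P0.
by field; rewrite !gt_eqF.
Unshelve. all: by end_near.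
Qed.

Lemma density_bound : ((2 * pi * (1 - d ^+ 2))%R%:E * upper_density Lam <= mu S)%E.
Proof.
have k0 : 0 < 2 * pi * (1 - d ^+ 2).
  by rewrite !mulr_gt0 ?pi_gt0// subr_gt0 expr_lt1// ltW.
have Sfin : mu S \is a fin_num.
  by rewrite ge0_fin_numE ?measure_ge0//; exact: lebesgue_measure_compact_lty.
rewrite /upper_density; set D := (fun r => ereal_sup _).
(* A divergent limit has the default value 0. *)
have [cD|/dvgP ->] := pselect (cvg (D @ +oo)); last by rewrite mule0 measure_ge0.
apply/lee_addgt0Pr => e e0.
have : (lim (D @ +oo%R) <= ((2 * pi * (1 - d ^+ 2))^-1 * (fine (mu S) + e))%:E)%E.
  by apply: lime_le => //; exact: window_density.
rewrite -(fineK Sfin) -EFinD -(@lee_pmul2l _ (2 * pi * (1 - d ^+ 2))%:E)// ?lte_fin//.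
by move/le_trans; apply; rewrite -EFinM lee_fin mulVKf// gt_eqF.
Qed.

End DensityBound.

(** * The integers and band-limited functions *)

Section IntegerLattice.
Context {R : realType}.

Definition Zset : set R := range (fun k : int => k%:~R).

Lemma Zset_gap (x y : R) : Zset x -> Zset y -> x != y -> 1 <= `|x - y|.
Proof.
move=> [k _ <-] [m _ <-]; rewrite eqr_int => km.
rewrite -intrB -intr_norm -[leLHS]/(1%:~R) ler_int.
by rewrite -gtz0_ge1 normr_gt0 subr_eq0.
Qed.

Lemma Zset_uniformly_discrete : uniformly_discrete Zset.
Proof.
rewrite /uniformly_discrete (@lt_le_trans _ _ 1%:E)// ?lte_fin//.
apply: le_ereal_inf_tmp => _ [x [y [Zx Zy xy ->]]].
by rewrite lee_fin Zset_gap.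
Qed.

Lemma counting_ge (A : set R) n (l : 'I_n -> R) : injective l ->
  (forall i, A (l i)) -> (n%:R%:E <= counting A :> \bar R)%E.
Proof.
move=> linj lA; rewrite /counting; case: ifPn => [/asboolP finA|_]; last exact: leey.
rewrite lee_fin ler_nat -[n]card_ord cardE -(size_map l).
apply: uniq_leq_size; first by rewrite map_inj_uniq ?enum_uniq.
by move=> _ /mapP[i _ ->]; rewrite in_fset_set// mem_set.
Qed.

Lemma upper_density_Zset : upper_density Zset = 1%E.
Proof.
rewrite /upper_density; set D := (fun r => ereal_sup _).
have inv0 : (r^-1 : R) @[r --> +oo] --> (0 : R).
  by apply/gtr0_cvgV0 => //; apply: nbhs_pinfty_gt; exact: num_real.
have lim1 (s : R) : (1 + s * r^-1)%:E @[r --> (+oo : set_system R)] --> 1%:E.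
  apply: cvg_EFin; first by apply: nearW.
  rewrite -[X in _ --> X]addr0 -[X in _ --> _ + X](mulr0 s).
  by apply: cvgD; [exact: cvg_cst|apply: cvgM => //; exact: cvg_cst].
suff : D @ +oo --> 1%:E by exact: cvg_lim.
apply: (@squeeze_cvge _ _ _ _ (fun r => (1 + -1 * r^-1)%:E) _
  (fun r => (1 + 1 * r^-1)%:E)); last 2 first.
- exact: lim1.
- exact: lim1.
near=> r; have r0 : 0 < r by near: r; apply: nbhs_pinfty_gt; exact: num_real.
have rn0 : r != 0 by rewrite gt_eqF.
have /andP[Tr rT] := truncn_itv (ltW r0); rewrite -natr1 in rT.
apply/andP; split.
  pose m := Num.truncn r; pose l (i : 'I_m) : R := (i : nat)%:R.
  have linj : injective l by move=> i j /eqP; rewrite eqr_nat => /eqP/val_inj.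
  apply: (@le_trans _ _ (counting (Zset `&` `](- 2^-1)%R, (- 2^-1 + r)%R[) *
      (r^-1)%:E)%E); last first.
    by apply: ereal_sup_ubound; exists (- 2^-1).
  apply: (@le_trans _ _ (m%:R%:E * (r^-1)%:E)%E).
    rewrite -EFinM lee_fin -[X in X + _](mulfV rn0) -mulrDl.
    by rewrite ler_pM2r ?invr_gt0//; move: rT; rewrite -/m; lra.
  apply: lee_wpmul2r; first by rewrite lee_fin invr_ge0 ltW.
  apply: (counting_ge linj) => i; split; first by exists (i : nat) => //; rewrite /l pmulrn.
  have : (i.+1%:R <= m%:R :> R) by rewrite ler_nat.
  rewrite /= in_itv/= /l -natr1 => im; have : 0 <= (i : nat)%:R :> R by [].
  by move: Tr; rewrite -/m => *; apply/andP; split; lra.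
apply: ge_ereal_sup => _ [a _ <-].
have win n (l : 'I_n -> R) : injective l -> (forall i, (Zset `&` `]a, (a + r)[) (l i)) ->
    (n <= (Num.truncn (r / 1)).+1)%N.
  move=> linj lL; apply: (card_window (l := l) (alpha := a)) => // [i j ij|i].
    by apply: Zset_gap; [case: (lL i)|case: (lL j)|apply: contraNneq ij => /linj ->].
  by case: (lL i) => _ /=; rewrite in_itv.
have [n [l [linj lL ->]]] := counting_enum win.
have := win n l linj lL; rewrite divr1 -(ler_nat R) -natr1 => nT.
rewrite -EFinM lee_fin -[X in _ <= X + _](mulfV rn0) -mulrDl ler_pM2r ?invr_gt0//.
by move: Tr nT; lra.
Unshelve. all: by end_near.
Qed.

End IntegerLattice.

Section Bessel.
Context {R : realType}.
Local Notation mu := (@lebesgue_measure R).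
Local Notation L1 f := (mu.-integrable setT (EFin \o f)).

Lemma integral_cos_sym (r k : R) : 0 < r -> k != 0 ->
  \int[mu]_(t in `[- r, r]) cos (k * t) = 2 * (sin (k * r) / k).
Proof.
move=> r0 k0; have rr : - r < r by rewrite gtrN.
have dF (x : R) : is_derive x 1 (fun t => sin (k * t) / k) (cos (k * x)).
  apply: is_derive_ext (is_deriveZ k^-1 (is_derive_sinM k x)) _ _ => [y|].
    by rewrite mulrC.
  by rewrite /GRing.scale /= mulKf.
have cF := is_derive_continuous dF.
rewrite /Rintegral (@continuous_FTC2 _ _ (fun t => sin (k * t) / k))//=.
- by rewrite mulrN sinN; field.
- by apply: continuous_subspaceT; exact: (is_derive_continuous (is_derive_cosM k)).
- split=> [x _||]; first by have dx := dF x; exact: ex_derive.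
  + exact/cvg_at_right_filter/cF.
  + exact/cvg_at_left_filter/cF.
- by move=> x _; rewrite derive1E; have dx := dF x; exact: derive_val.
Qed.

Lemma integral_sin_sym (r k : R) : 0 < r ->
  \int[mu]_(t in `[- r, r]) sin (k * t) = 0.
Proof.
move=> r0; have rr : - r < r by rewrite gtrN.
have [->|k0] := eqVneq k 0.
  by under eq_Rintegral do rewrite mul0r sin0; rewrite Rintegral_cst// mul0r.
have dF (x : R) : is_derive x 1 (fun t => - (cos (k * t) / k)) (sin (k * x)).
  apply: is_derive_ext (is_deriveZ (- k^-1) (is_derive_cosM k x)) _ _ => [y|].
    by rewrite -[LHS]/(- k^-1 * cos (k * y)) mulNr mulrC.
  by rewrite /GRing.scale /= mulrNN mulKf.
have cF := is_derive_continuous dF.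
rewrite /Rintegral (@continuous_FTC2 _ _ (fun t => - (cos (k * t) / k)))//=.
- by rewrite mulrN cosN; ring.
- by apply: continuous_subspaceT; exact: (is_derive_continuous (is_derive_sinM k)).
- split=> [x _||]; first by have dx := dF x; exact: ex_derive.
  + exact/cvg_at_right_filter/cF.
  + exact/cvg_at_left_filter/cF.
- by move=> x _; rewrite derive1E; have dx := dF x; exact: derive_val.
Qed.

Lemma sin_int_pi (k : int) : sin (k%:~R * pi) = 0 :> R.
Proof.
have N (n : nat) : sin (n%:R * pi) = 0 :> R.
  elim: n => [|n IH]; first by rewrite mul0r sin0.
  by rewrite -natr1 mulrDl mul1r sinDpi IH oppr0.
by case: k => n; rewrite ?NegzE ?mulrNz ?mulNr ?sinN ?N ?oppr0//; exact: N.
Qed.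

Lemma integral_cos_period (k : int) :
  \int[mu]_(t in `[- pi, pi]) cos (k%:~R * t) = (2 * pi) * (k == 0)%:R.
Proof.
have [->|k0] := eqVneq k 0.
  under eq_Rintegral do rewrite mul0r cos0.
  by rewrite Rintegral_cst//= lebesgue_measure_itv/= lte_fin gtrN ?pi_gt0//= mul1r mulr1; ring.
by rewrite integral_cos_sym ?pi_gt0 ?intr_eq0// sin_int_pi mul0r !mulr0.
Qed.

Lemma Rintegral_itv_sum (I : eqType) (s : seq I) (G : I -> R -> R) (a b : R) :
  (forall i, continuous (G i)) ->
  continuous (fun t => \sum_(i <- s) G i t) /\
  \int[mu]_(t in `[a, b]) (\sum_(i <- s) G i t) = \sum_(i <- s) \int[mu]_(t in `[a, b]) G i t.
Proof.
move=> cG; elim: s => [|i s [IH1 IH2]].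
  split; first by under eq_fun do rewrite big_nil; move=> t; exact: cvg_cst.
  by under eq_Rintegral do rewrite big_nil; rewrite Rintegral_cst// mul0r big_nil.
split.
  under eq_fun do rewrite big_cons.
  by move=> t; apply: cvgD; [exact: cG|exact: IH1].
under eq_Rintegral do rewrite big_cons.
by rewrite RintegralD ?IH2 ?big_cons//; apply: integrable_itv.
Qed.

Variable c : R.
Hypotheses (c0 : 0 < c) (c1 : c < 1).
Let b := pi * c.

Let b0 : 0 < b. Proof. by rewrite mulr_gt0 ?pi_gt0. Qed.

(** The inverse Fourier transform of the indicator of [-b, b]; at the integers,
    its values are the Fourier coefficients of that indicator on [-pi, pi]. *)
Definition band (y : R) := (2 * pi)^-1 * \int[mu]_(t in `[- b, b]) cos (y * t).

Lemma band0 : band 0 = c.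
Proof.
rewrite /band; under eq_Rintegral do rewrite mul0r cos0.
rewrite Rintegral_cst//= lebesgue_measure_itv/= lte_fin gtrN//= mul1r opprK.
have p0 := pi_gt0 R; rewrite /b; move: (@pi R) p0 => P P0.
by field; rewrite gt_eqF.
Qed.

(** Bessel's inequality: for the trigonometric polynomial T with coefficients
    band m, expand the integral of |1 - T|^2 over [-b, b] and use that the
    integral of |T|^2 over [-b, b] is at most that over a period.  Here Cs and
    Ss are the real and imaginary parts of T, and Q = |T|^2. *)
Lemma bessel_band (s : seq int) : uniq s -> \sum_(m <- s) band m%:~R ^+ 2 <= c.
Proof.
move=> us; pose a (m : int) := band m%:~R.
pose Cs t := \sum_(m <- s) a m * cos (m%:~R * t).
pose Ss t := \sum_(m <- s) a m * sin (m%:~R * t).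
pose Q t := Cs t ^+ 2 + Ss t ^+ 2.
have cM (g : R -> R) (k : R) : continuous g -> continuous (fun t => k * g t).
  by move=> cg t; apply: cvgM; [exact: cvg_cst|exact: cg].
have ccos (k : R) : continuous (fun t => cos (k * t)) := is_derive_continuous (is_derive_cosM k).
have csin (k : R) : continuous (fun t => sin (k * t)) := is_derive_continuous (is_derive_sinM k).
have [cCs iCs] := @Rintegral_itv_sum _ s (fun m t => a m * cos (m%:~R * t)) (- b) b
  (fun m => cM _ _ (ccos _)).
have [cSs _] := @Rintegral_itv_sum _ s (fun m t => a m * sin (m%:~R * t)) (- b) b
  (fun m => cM _ _ (csin _)).
have sq (g : R -> R) : continuous g -> continuous (fun t => g t ^+ 2).
  by move=> cg t; under eq_fun do rewrite expr2; apply: cvgM; exact: cg.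
have cQ : continuous Q by move=> t; apply: cvgD; apply: sq.
have p20 : 0 < 2 * pi :> R by rewrite mulr_gt0 ?pi_gt0.
set A := \sum_(m <- s) _.
have ICs : \int[mu]_(t in `[- b, b]) Cs t = 2 * pi * A.
  rewrite iCs mulr_sumr; apply: eq_bigr => m _.
  rewrite RintegralZl//; last exact: integrable_itv.
  by rewrite -/(a m) expr2 mulrCA; congr (_ * _); rewrite /a /band mulVKf// gt_eqF.
have IQ : \int[mu]_(t in `[- pi, pi]) Q t = 2 * pi * A.
  have QE t : Q t = \sum_(m <- s) \sum_(l <- s) a m * a l * cos ((m - l)%:~R * t).
    rewrite /Q /Cs /Ss !expr2 !big_distrlr /= -big_split /=; apply: eq_bigr => m _.
    rewrite -big_split /=; apply: eq_bigr => l _.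
    by rewrite intrB mulrBl cosB; ring.
  under eq_Rintegral do rewrite QE.
  have cml m l : continuous (fun t : R => a m * a l * cos ((m - l)%:~R * t)) by apply: cM.
  have cm m : continuous (fun t : R => \sum_(l <- s) a m * a l * cos ((m - l)%:~R * t)).
    exact: (@Rintegral_itv_sum _ s _ 0 0 (cml m)).1.
  rewrite (@Rintegral_itv_sum _ s _ (- pi) pi cm).2 /A mulr_sumr.
  rewrite big_seq [RHS]big_seq; apply: eq_bigr => m ms.
  rewrite (@Rintegral_itv_sum _ s _ (- pi) pi (cml m)).2.
  rewrite (bigD1_seq m)//= big1 ?addr0 => [|l lm].
    rewrite RintegralZl//; last exact: integrable_itv.
    by rewrite integral_cos_period subrr eqxx mulr1 expr2 mulrC.
  rewrite RintegralZl//; last exact: integrable_itv.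
  by rewrite integral_cos_period subr_eq0 eq_sym (negbTE lm) !mulr0.
have QB : \int[mu]_(t in `[- b, b]) Q t <= \int[mu]_(t in `[- pi, pi]) Q t.
  rewrite /Rintegral fine_le//; try (apply: integrable_fin_num => //; exact: integrable_itv).
  apply: ge0_subset_integral => //.
  - by apply/measurable_EFinP; apply: measurable_funTS; exact: continuous_measurable_fun.
  - by move=> t _; rewrite lee_fin addr_ge0 ?sqr_ge0.
  - have bp : b <= pi by rewrite /b ler_piMr ?pi_ge0// ltW.
    by move=> t /=; rewrite !in_itv/= => /andP[? ?]; apply/andP; split; lra.
have : 0 <= \int[mu]_(t in `[- b, b]) ((1 - 2 * Cs t) + Q t).
  apply: Rintegral_ge0 => t _; rewrite /Q.
  suff -> : 1 - 2 * Cs t + (Cs t ^+ 2 + Ss t ^+ 2) = (1 - Cs t) ^+ 2 + Ss t ^+ 2.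
    by rewrite addr_ge0 ?sqr_ge0.
  by ring.
have c2 : continuous (fun t => 2 * Cs t) by exact: cM.
have c12 : continuous (fun t => 1 - 2 * Cs t).
  by move=> t; apply: cvgB; [exact: cvg_cst|exact: c2].
rewrite RintegralD//; try exact: integrable_itv.
rewrite RintegralB//; try exact: integrable_itv; last by apply: integrable_itv => t; exact: cvg_cst.
rewrite RintegralZl//; last exact: integrable_itv.
rewrite ICs Rintegral_cst//= lebesgue_measure_itv/= lte_fin gtrN//= mul1r opprK.
move: QB; rewrite IQ => QB h.
suff : 2 * pi * A <= 2 * pi * c by rewrite ler_pM2l.
suff -> : 2 * pi * c = b + b by move: h QB; clear; lra.
by rewrite /b; ring.
Qed.

(** By [band0] the term m = 0 is (1 - c)^2, and by [bessel_band] the others add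
    up to at most c - c^2. *)
Lemma band_error (s : seq int) : uniq s ->
  \sum_(m <- s) (band m%:~R - (m == 0)%:R) ^+ 2 <= 1 - c.
Proof.
have H (s' : seq int) : uniq s' -> 0 \in s' ->
    \sum_(m <- s') (band m%:~R - (m == 0)%:R) ^+ 2 <= 1 - c.
  move=> us s0; have := bessel_band us.
  rewrite !(bigD1_seq 0 s0 us)/= band0 => h.
  rewrite (eq_bigr (fun m : int => band m%:~R ^+ 2)); last first.
    by move=> m /negbTE ->; rewrite subr0.
  by move: h; set B := \sum_(_ <- _ | _) _; lra.
move=> us; have [s0|s0] := boolP (0 \in s); first exact: H.
have := H (0 :: s); rewrite /= s0 us inE eqxx => /(_ isT isT).
by apply: le_trans; rewrite big_cons lerDr sqr_ge0.
Qed.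

End Bessel.

Section SincFunctions.
Context {R : realType}.
Local Notation mu := (@lebesgue_measure R).
Local Notation L1 f := (mu.-integrable setT (EFin \o f)).
Local Open Scope complex_scope.

Variable c : R.
Hypotheses (c0 : 0 < c) (c1 : c < 1).
Let b := pi * c.
Let p := (2 * pi)^-1 : R.
Let b0 : 0 < b. Proof. by rewrite mulr_gt0 ?pi_gt0. Qed.
Let p0 : 0 < p. Proof. by rewrite invr_gt0 mulr_gt0 ?pi_gt0. Qed.

(** The exponential e^(-i xi t) / (2 pi), cut off outside [-b, b]. *)
Definition tone (xi t : R) : R[i] :=
  if t \in `[- b, b] then (p * cos (xi * t)) +i* (- (p * sin (xi * t))) else 0.

Lemma continuous_tone (xi : R) :
  continuous (fun t => p * cos (xi * t)) /\ continuous (fun t => - (p * sin (xi * t))).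
Proof.
split=> t.
  by apply: cvgM; [exact: cvg_cst|exact: (is_derive_continuous (is_derive_cosM xi))].
apply: cvgN; apply: cvgM; [exact: cvg_cst|].
exact: (is_derive_continuous (is_derive_sinM xi)).
Qed.

Lemma L1_tone (xi : R) : L1 (fun t => complex.Re (tone xi t)) /\
  L1 (fun t => complex.Im (tone xi t)).
Proof.
have [h1 h2] := continuous_tone xi; split.
  rewrite [X in L1 X](_ : _ = (fun t => p * cos (xi * t)) \_ `[- b, b]).
    by rewrite -restrict_EFin; apply/(integrable_mkcond _ _).1 => //; exact: integrable_itv.
  by apply/funext => t; rewrite patchE /tone mem_setE; case: ifP.
rewrite [X in L1 X](_ : _ = (fun t => - (p * sin (xi * t))) \_ `[- b, b]).
  by rewrite -restrict_EFin; apply/(integrable_mkcond _ _).1 => //; exact: integrable_itv.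
by apply/funext => t; rewrite patchE /tone mem_setE; case: ifP.
Qed.

Lemma fourier_tone (xi x : R) : fourier (tone xi) x = (band c (x - xi))%:C.
Proof.
rewrite /fourier /integralC; congr (_ +i* _).
  rewrite /band -RintegralZl//; last first.
    by apply: integrable_itv; exact: (is_derive_continuous (is_derive_cosM _)).
  rewrite [RHS]Rintegral_mkcond; apply: eq_Rintegral => t _.
  rewrite patchE /tone mem_setE; case: ifP => _ /=; last by rewrite !mulr0 subr0.
  by rewrite mulrBl cosB (mulrC t) -/p; ring.
transitivity (\int[mu]_(t in `[- b, b]) (p * sin ((x - xi) * t))).
  rewrite [RHS]Rintegral_mkcond; apply: eq_Rintegral => t _.
  rewrite patchE /tone mem_setE; case: ifP => _ /=; last by rewrite !mulr0 addr0.
  by rewrite mulrBl sinB (mulrC t); ring.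
rewrite RintegralZl//; last first.
  by apply: integrable_itv; exact: (is_derive_continuous (is_derive_sinM _)).
by rewrite integral_sin_sym// mulr0.
Qed.

Lemma L2_tone (xi : R) : L2 (tone xi).
Proof.
have [h1 h2] := L1_tone xi; split.
  by split; apply/measurable_EFinP; [exact: (measurable_int mu h1)|exact: (measurable_int mu h2)].
apply: (@lty_poweRy _ _ 2) => //; rewrite -L2norm_sqr.
have : (\int[mu]_x (complex.Re (tone xi x) ^+ 2 + complex.Im (tone xi x) ^+ 2)%:E <=
    \int[mu]_(x in `[(- b)%R, b]) (p ^+ 2)%:E)%E.
  rewrite [leRHS]integral_mkcond; apply: ge0_le_integral => //.
  - by move=> x _; rewrite lee_fin addr_ge0 ?sqr_ge0.
  - apply/measurable_EFinP; apply: measurable_funD; apply: measurable_funX;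
    by apply/measurable_EFinP; exact: (measurable_int mu h1) || exact: (measurable_int mu h2).
  - apply: (measurable_restrictT (fun=> (p ^+ 2)%:E) _).1; first exact: measurable_itv.
    exact: measurable_cst.
  - move=> t _; rewrite patchE /tone mem_setE; case: ifP => _ /=.
      by rewrite lee_fin sqrrN !exprMn -mulrDr cos2Dsin2 mulr1.
    by rewrite lee_fin expr0n addr0.
by move=> /le_lt_trans; apply; rewrite integral_cst//= lebesgue_measure_itv/= lte_fin gtrN// ltry.
Qed.

(** Both |band y| and |y band y| are at most 1. *)
Lemma band_decay (y : R) : band c y ^+ 2 <= 2 * (1 / (1 ^+ 2 + y ^+ 2)).
Proof.
have sq1 (z : R) : `|z| <= 1 -> z ^+ 2 <= 1.
  by move=> z1; rewrite -real_normK ?num_real// expr_le1.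
have pb : p * (2 * b) = c.
  rewrite /p /b; have pi0 := pi_gt0 R; move: (@pi R) pi0 => P P0.
  by field; rewrite gt_eqF.
have icos : mu.-integrable `[- b, b] (EFin \o (fun t => cos (y * t))).
  by apply: integrable_itv; exact: (is_derive_continuous (is_derive_cosM y)).
have q1 : band c y ^+ 2 <= 1.
  apply: sq1; rewrite /band -/b -/p normrM (gtr0_norm p0) (le_trans _ (ltW c1))//.
  rewrite -[leRHS]pb ler_pM2l//.
  rewrite (le_trans (le_normr_Rintegral _ icos))//.
  have -> : 2 * b = \int[mu]_(t in `[- b, b]) (1 : R).
    by rewrite Rintegral_cst//= lebesgue_measure_itv/= lte_fin gtrN//= mul1r; ring.
  apply: le_Rintegral => //; first exact: integrable_norm.
    by apply: integrable_itv => t; exact: cvg_cst.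
  by move=> t _; exact: cos_max.
have q2 : (band c y * y) ^+ 2 <= 1.
  have [->|y0] := eqVneq y 0; first by rewrite mulr0 expr0n.
  apply: sq1; rewrite /band -/b integral_cos_sym// -/p.
  have -> : p * (2 * (sin (y * b) / y)) * y = pi^-1 * sin (y * b).
    have pi0 := pi_gt0 R; rewrite /p; move: (@pi R) pi0 (sin _) => P P0 z.
    by field; rewrite y0 gt_eqF.
  rewrite normrM mulr_ile1//; last exact: sin_max.
  rewrite ger0_norm ?invr_ge0 ?pi_ge0// invf_le1 ?pi_gt0//.
  by rewrite (le_trans _ (pi_ge2 R))// ler1n.
rewrite expr1n mulrA mulr1 ler_pdivlMr ?ltr_pwDl ?sqr_ge0//.
by rewrite mulrDr mulr1 -exprMn -[leRHS]natr1 lerD.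
Qed.

Lemma poisson_mass (xi : R) : (\int[mu]_s (1 / (1 ^+ 2 + (xi - s) ^+ 2))%:E <= pi%:E)%E.
Proof.
pose F (n : nat) : set R := [set` `[xi - n.+1%:R, xi + n.+1%:R]].
have K0 (u : R) : 0 <= 1 / (1 ^+ 2 + u ^+ 2) by rewrite divr_ge0// addr_ge0 ?sqr_ge0.
have cK : continuous (fun s : R => 1 / (1 ^+ 2 + (xi - s) ^+ 2)) .
  exact: continuous_poisson.
have UF : \bigcup_n F n = setT.
  apply/seteqP; split => // s _; have [n hn] : exists n : nat, `|s - xi| <= n.+1%:R.
    exists (Num.truncn `|s - xi|); have /andP[_] := truncn_itv (normr_ge0 (s - xi)).
    exact: ltW.
  by exists n => //; rewrite /F /= in_itv/= -ler_distl.
have mF n : measurable (F n) by exact: measurable_itv.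
have lim : (\int[mu]_(s in F n) (1 / (1 ^+ 2 + (xi - s) ^+ 2))%:E)%E @[n --> \oo] -->
    (\int[mu]_s (1 / (1 ^+ 2 + (xi - s) ^+ 2))%:E)%E.
  rewrite -UF; apply: ge0_nondecreasing_set_cvg_integral => //.
  - move=> n m nm; apply/subsetPset => s; rewrite /F /= !in_itv/=.
    have : n.+1%:R <= m.+1%:R :> R by rewrite ler_nat.
    by move=> h /andP[h1 h2]; apply/andP; split; lra.
  - by move=> n; apply/measurable_EFinP; apply: measurable_funTS; exact: continuous_measurable_fun.
  - by move=> n s _; rewrite lee_fin.
apply: (cvge_to_le lim); apply: nearW => n.
have lt : xi - n.+1%:R < xi + n.+1%:R.
  by rewrite ltrD2l gtrN.
have iF : mu.-integrable (F n) (EFin \o (fun s => 1 / (1 ^+ 2 + (xi - s) ^+ 2))).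
  exact: integrable_itv.
rewrite -[leLHS]fineK; last by apply: integrable_fin_num iF; exact: measurable_itv.
rewrite -/(Rintegral _ _ _) integral_poisson// lee_fin !divr1.
have := atan_ltpi2 (xi + n.+1%:R - xi); have := atan_gtNpi2 (xi - n.+1%:R - xi).
by lra.
Qed.

Lemma cmeasurable_fourier_tone (xi : R) : cmeasurable_fun (fourier (tone xi)).
Proof.
have [h1 h2] := L1_tone xi.
have cc := @continuous_cos R; have cs := @continuous_sin R.
have cm := @cos_max R; have sm := @sin_max R.
split; under eq_fun do rewrite fourierE//=.
  by apply: measurable_funB; exact: measurable_transform.
by apply: measurable_funD; exact: measurable_transform.
Qed.

Lemma energy_fourier_tone (xi : R) :
  (\int[mu]_x (complex.Re (fourier (tone xi) x) ^+ 2 +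
                complex.Im (fourier (tone xi) x) ^+ 2)%:E <= (2 * pi)%:E)%E.
Proof.
have -> : (2 * pi)%:E = (2%:E * pi%:E)%E :> \bar R by rewrite EFinM.
apply: (@le_trans _ _ (2%:E * \int[mu]_s (1 / (1 ^+ 2 + (xi - s) ^+ 2))%:E)%E); last first.
  by rewrite lee_pmul2l ?lte_fin// poisson_mass.
have mK : measurable_fun [set: R] (fun s : R => 1 / (1 ^+ 2 + (xi - s) ^+ 2)).
  by apply: continuous_measurable_fun; exact: continuous_poisson.
have K0 (u : R) : 0 <= 1 / (1 ^+ 2 + u ^+ 2) by rewrite divr_ge0// addr_ge0 ?sqr_ge0.
rewrite -ge0_integralZl//; [|exact/measurable_EFinP|by move=> x _; rewrite lee_fin].
have [m1 m2] := cmeasurable_fourier_tone xi.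
apply: ge0_le_integral => //.
- by move=> x _; rewrite lee_fin addr_ge0 ?sqr_ge0.
- by apply/measurable_EFinP; apply: measurable_funD; exact: measurable_funX.
- by apply/measurable_EFinP; exact: measurable_funM.
- move=> x _; rewrite fourier_tone/= expr0n addr0 -EFinM lee_fin.
  by rewrite (le_trans (band_decay _))// -(opprB x xi) sqrrN.
Qed.

Lemma L2_fourier_tone (xi : R) : L2 (fourier (tone xi)) /\
  (L2norm (fourier (tone xi)) <= (2 * pi)%:E `^ 2^-1)%E.
Proof.
have h : (L2norm (fourier (tone xi)) <= (2 * pi)%:E `^ 2^-1)%E.
  have := energy_fourier_tone xi; rewrite L2norm_sqr => h.
  have <- : ((L2norm (fourier (tone xi)) `^ 2) `^ 2^-1 = L2norm (fourier (tone xi)))%E.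
    by rewrite -poweRrM mulfV// poweRe1// Lnorm_ge0.
  apply: gt0_ler_poweR => //; rewrite in_itv/= leey andbT.
    exact: poweR_ge0.
  by rewrite lee_fin mulr_ge0 ?pi_ge0.
split=> //; split; first exact: cmeasurable_fourier_tone.
by rewrite (le_lt_trans h)// poweR_EFin ltry.
Qed.

Lemma PW_fourier_tone (xi : R) : PW `[- b, b] (fourier (tone xi)).
Proof.
split; first exact: (L2_fourier_tone xi).1.
exists (tone xi); split => //; first exact: L2_tone.
by move=> t /= /negP tb; rewrite /tone (negbTE tb).
Qed.

Lemma l2norm_le (Lam : set R) (v : R -> R[i]) (d : R) : 0 <= d ->
  (forall s : seq R, uniq s -> (forall x, x \in s -> Lam x) ->
     \sum_(x <- s) Normc.normc (v x) ^+ 2 <= d ^+ 2) ->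
  (l2norm Lam v <= d%:E)%E.
Proof.
move=> d0 h; rewrite /l2norm.
have -> : d%:E = ((d ^+ 2)%:E `^ 2^-1)%E.
  by rewrite -(@powR_mulrn _ _ 2)// -poweR_EFin -poweRrM mulfV// poweRe1.
apply: gt0_ler_poweR => //; rewrite ?in_itv/= ?leey ?andbT.
- by apply: esum_ge0 => x _; rewrite lee_fin sqr_ge0.
- by rewrite lee_fin sqr_ge0.
apply: ge_ereal_sup => _ [A [finA AL] <-].
rewrite fsbig_finite//= sumEFin lee_fin h ?fset_uniq// => x.
by rewrite in_fset_set// => /set_mem/AL.
Qed.

(** Over the integers the differences l - xi run over distinct integers, so
    [band_error] bounds every finite part of the sum. *)
Lemma l2norm_tone_delta (d : R) (xi : R) : 0 <= d -> 1 - c <= d ^+ 2 -> Zset xi ->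
  (l2norm Zset (fun l => (fourier (tone xi) l - delta xi l)%R) <= d%:E)%E.
Proof.
move=> d0 cd [k _ <-]; apply: l2norm_le => // s us sZ.
apply: le_trans cd; pose m (x : R) := Num.floor x - k.
have mE x : x \in s -> (m x)%:~R = x - k%:~R.
  by move=> /sZ[j _ <-]; rewrite /m intrKfloor intrB.
apply: le_trans (band_error c0 c1 (s := map m s) _).
  rewrite big_map big_seq [leRHS]big_seq; apply: ler_sum => x xs.
  rewrite fourier_tone mE// /delta normc_sqr -subr_eq0 -mE// intr_eq0.
  by case: (_ == 0) => /=; rewrite !(subr0, expr0n, addr0).
rewrite map_inj_in_uniq// => x y xs ys mxy.
by apply: (subIr k%:~R); rewrite /= -!mE// mxy.
Qed.

End SincFunctions.

Theorem theorem1 (R : realType) (d : R) (d_gt0 : 0 < d) (d_lt1 : d < 1) :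
  (forall (S : set R) (Lam : set R) (f : R -> R -> R[i]),
     compact S ->
     uniformly_discrete Lam ->
     (forall xi, Lam xi -> PW S (f xi)) ->
     (ereal_sup [set L2norm (f xi) | xi in Lam] < +oo)%E ->
     (forall xi, Lam xi ->
        (l2norm Lam (fun l => f xi l - delta xi l)%R <= d%:E)%E) ->
     ((2 * pi * (1 - d ^+ 2))%R%:E * upper_density Lam
        <= lebesgue_measure S)%E)
  /\
  (exists (S : set R) (Lam : set R) (f : R -> R -> R[i]),
     compact S /\
     uniformly_discrete Lam /\
     (forall xi, Lam xi -> PW S (f xi)) /\
     (ereal_sup [set L2norm (f xi) | xi in Lam] < +oo)%E /\
     (forall xi, Lam xi ->
        (l2norm Lam (fun l => f xi l - delta xi l)%R <= d%:E)%E) /\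
     lebesgue_measure S =
       ((2 * pi * (1 - d ^+ 2))%R%:E * upper_density Lam)%E /\
     (0 < upper_density Lam)%E).
Proof.
split=> [S Lam f cS udL fPW fsup fd|].
  exact: density_bound d_gt0 d_lt1 cS udL fPW fsup fd.
pose c : R := 1 - d ^+ 2; have d2 : d ^+ 2 < 1 by rewrite expr_lt1// ltW.
have c0 : 0 < c by rewrite subr_gt0.
have c1 : c < 1 by rewrite ltrBlDr ltrDl exprn_gt0.
exists [set` `[- (pi * c), pi * c]], Zset, (fun xi => fourier (tone c xi)).
split; first exact: segment_compact.
split; first exact: Zset_uniformly_discrete.
split=> [xi _|]; first exact: PW_fourier_tone.
split.
  apply: (@le_lt_trans _ _ ((2 * pi)%:E `^ 2^-1)%E); last by rewrite poweR_EFin ltry.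
  by apply: ge_ereal_sup => _ [xi _ <-]; exact: (L2_fourier_tone c0 c1 xi).2.
split=> [xi Zxi|].
  by apply: l2norm_tone_delta => //; [exact: ltW|rewrite subKr].
rewrite upper_density_Zset mule1; split=> //.
rewrite /= lebesgue_measure_itv/= lte_fin gtrN ?mulr_gt0 ?pi_gt0//.
by rewrite -EFinD opprK -mulr2n -[in LHS]mulr_natl mulrA.
Qed.
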